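(* Let $\theta\in\mathbb N$, $I=\{1,2,\dots,\theta\}$, $A=\{x,y\}$ with $x\neq y$, let $\mathcal C=\mathcal C(I,A,(\rho_i)_{i\in I},(C^a)_{a\in A})$ be a connected Cartan scheme and $\mathcal R=\mathcal R(\mathcal C,(R^a)_{a\in A})$ a root system of type $\mathcal C$. Let $\kappa\in I$ be such that $\rho_i(x)=y$, $\rho_i(y)=x$ for $1\le i\le\kappa$ and $\rho_i(x)=x$, $\rho_i(y)=y$ for $\kappa<i\le\theta$. If $\mathcal R$ is finite and irreducible, then, up to permutation of $\{x,y\}$ and of $I$, one of the following holds: (1) $\kappa\in\{1,\dots,\theta\}$ is arbitrary, and $C^x=C^y$ is an indecomposable Cartan matrix of finite type such that $c^x_{ij}c^x_{ji}\neq 1$ for all $i,j$ with $i\le\kappa<j$; (2) $\theta=2$, $\kappa=1$, $c^x_{12}=c^y_{12}=-1$, $c^x_{21}=-3$, $c^y_{21}\in\{-4,-5\}$; (3) $\theta=3$, $\kappa=1$, $C^x=\begin{pmatrix}2&-1&0\\-2&2&-1\\0&-1&2\end{pmatrix}$, $C^y=\begin{pmatrix}2&-1&0\\-2&2&-2\\0&-1&2\end{pmatrix}$; (4) $\theta=3$, $\kappa=1$, $C^x=\begin{pmatrix}2&-2&0\\-1&2&-1\\0&-1&2\end{pmatrix}$, $C^y=\begin{pmatrix}2&-2&0\\-1&2&-2\\0&-1&2\end{pmatrix}$. Conversely, if $C^x,C^y$ satisfy one of the conditions (1)–(4), then $\mathcal R$ is finite and irreducible.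
   Context: Let $I$ be a nonempty finite set and $\{\alpha_i\mid i\in I\}$ the standard basis of $\mathbb Z^I$; $\mathbb N=\{1,2,\dots\}$, $\mathbb N_0=\mathbb N\cup\{0\}$. A generalized Cartan matrix is $C=(c_{ij})_{i,j\in I}\in\mathbb Z^{I\times I}$ with $c_{ii}=2$, $c_{jk}\le0$ for $j\ne k$, and $c_{ij}=0\Rightarrow c_{ji}=0$. A Cartan scheme $\mathcal C=\mathcal C(I,A,(\rho_i)_{i\in I},(C^a)_{a\in A})$ consists of a nonempty set $A$, maps $\rho_i:A\to A$ and generalized Cartan matrices $C^a=(c^a_{jk})_{j,k\in I}$ ($a\in A$) such that (C1) $\rho_i^2=\mathrm{id}$ and (C2) $c^a_{ij}=c^{\rho_i(a)}_{ij}$ for all $a\in A$, $i,j\in I$. It is connected if the group generated by the $\rho_i$ acts transitively on $A$. For $i\in I$, $a\in A$ let $\sigma_i^a\in\mathrm{Aut}(\mathbb Z^I)$, $\sigma_i^a(\alpha_j)=\alpha_j-c^a_{ij}\alpha_i$. A root system of type $\mathcal C$ is a family $\mathcal R=\mathcal R(\mathcal C,(R^a)_{a\in A})$ of subsets $R^a\subset\mathbb Z^I$ such that, writing $R^a_+=R^a\cap\mathbb N_0^I$ and $m^a_{i,j}=|R^a\cap(\mathbb N_0\alpha_i+\mathbb N_0\alpha_j)|$, for all $a\in A$, $i,j\in I$: (R1) $R^a=R^a_+\cup(-R^a_+)$; (R2) $R^a\cap\mathbb Z\alpha_i=\{\alpha_i,-\alpha_i\}$; (R3) $\sigma_i^a(R^a)=R^{\rho_i(a)}$;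 (R4) if $i\neq j$ and $m^a_{i,j}$ is finite then $(\rho_i\rho_j)^{m^a_{i,j}}(a)=a$. It is finite if every $R^a$ is finite. $\mathcal R$ is reducible if there exist nonempty disjoint $I_1,I_2\subset I$ with $I=I_1\cup I_2$ and $R^a=(R^a\cap\sum_{i\in I_1}\mathbb Z\alpha_i)\cup(R^a\cap\sum_{j\in I_2}\mathbb Z\alpha_j)$ for all $a\in A$; otherwise it is irreducible. ''Cartan matrix of finite type'' and ''indecomposable'' are in the usual sense of Kac–Moody theory. *)

(* Defs.v *)
From HB Require Import structures.
From mathcomp Require Import all_boot all_order all_algebra all_fingroup.
From mathcomp Require Import Rstruct.

Set Implicit Arguments.
Unset Strict Implicit.
Unset Printing Implicit Defensive.
Import Order.TTheory GRing.Theory Num.Theory.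
Local Open Scope ring_scope.

(* Index set I = 'I_n (the paper's {1,...,theta} shifted to {0,...,theta-1}).
   Z^I is represented by row vectors 'rV[int]_n; alpha i is the standard basis. *)
Definition alpha (n : nat) (i : 'I_n) : 'rV[int]_n := delta_mx 0 i.

Definition gcm (n : nat) (C : 'M[int]_n) : Prop :=
  (forall i, C i i = 2) /\ (forall j k, j != k -> C j k <= 0) /\
  (forall i j, C i j = 0 -> C j i = 0).

Definition cartan_scheme (n : nat) (A : Type) (rho : 'I_n -> A -> A)
  (C : A -> 'M[int]_n) : Prop :=
  (forall a, gcm (C a)) /\
  (forall i a, rho i (rho i a) = a) /\
  (forall a i j, C (rho i a) i j = C a i j).

(* connected: the group generated by the rho_i acts transitively on A; since the
   rho_i are involutions, its elements are the finite composites of rho_i's *)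
Definition connected (n : nat) (A : Type) (rho : 'I_n -> A -> A) : Prop :=
  forall a b : A, exists s : seq 'I_n, foldr (fun i c => rho i c) a s = b.

(* sigma_i^a (v) = v - (sum_j c^a_ij v_j) alpha_i, i.e. sigma_i^a(alpha_j) = alpha_j - c^a_ij alpha_i *)
Definition sigma (n : nat) (A : Type) (C : A -> 'M[int]_n) (i : 'I_n) (a : A)
  (v : 'rV[int]_n) : 'rV[int]_n :=
  v - (\sum_j C a i j * v 0 j) *: alpha i.

Definition nonneg (n : nat) (v : 'rV[int]_n) : Prop := forall j, 0 <= v 0 j.

Definition has_card (n : nat) (P : 'rV[int]_n -> Prop) (m : nat) : Prop :=
  exists s : seq 'rV[int]_n, uniq s /\ (forall v, v \in s <-> P v) /\ size s = m.

Definition rank2_part (n : nat) (P : 'rV[int]_n -> Prop) (i j : 'I_n)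
  (v : 'rV[int]_n) : Prop :=
  P v /\ exists k l : nat, v = (k%:Z) *: alpha i + (l%:Z) *: alpha j.

Definition root_system (n : nat) (A : Type) (rho : 'I_n -> A -> A)
  (C : A -> 'M[int]_n) (R : A -> 'rV[int]_n -> Prop) : Prop :=
  cartan_scheme rho C /\
  (forall a v, R a v <-> ((R a v /\ nonneg v) \/ (R a (- v) /\ nonneg (- v)))) /\
  (forall a i v, (R a v /\ exists k : int, v = k *: alpha i) <->
                 (v = alpha i \/ v = - alpha i)) /\
  (forall a i w, R (rho i a) w <-> exists v, R a v /\ w = sigma C i a v) /\
  (forall a i j m, i != j -> has_card (rank2_part (R a) i j) m ->
     iter m (fun b => rho i (rho j b)) a = a).

Definition finite_rs (n : nat) (A : Type) (R : A -> 'rV[int]_n -> Prop) : Prop :=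
  forall a, exists s : seq 'rV[int]_n, forall v, R a v -> v \in s.

Definition in_span (n : nat) (S : {set 'I_n}) (v : 'rV[int]_n) : Prop :=
  forall j, j \notin S -> v 0 j = 0.

Definition reducible (n : nat) (A : Type) (R : A -> 'rV[int]_n -> Prop) : Prop :=
  exists I1 I2 : {set 'I_n},
    I1 != set0 /\ I2 != set0 /\ [disjoint I1 & I2] /\ I1 :|: I2 = setT /\
    forall a v, R a v <-> ((R a v /\ in_span I1 v) \/ (R a v /\ in_span I2 v)).

Definition irreducible (n : nat) (A : Type) (R : A -> 'rV[int]_n -> Prop) : Prop :=
  ~ reducible R.

Definition indecomposable (n : nat) (C : 'M[int]_n) : Prop :=
  ~ exists I1 : {set 'I_n}, I1 != set0 /\ ~: I1 != set0 /\
      forall i j, i \in I1 -> j \notin I1 -> C i j = 0.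

(* Kac, Infinite dimensional Lie algebras, Thm 4.3 / Def.: an (indecomposable)
   generalized Cartan matrix is of finite type iff (Fin) holds over the reals:
   det A <> 0; there is u > 0 with A u > 0; A v >= 0 implies v > 0 or v = 0. *)
Definition finite_type (n : nat) (C : 'M[int]_n) : Prop :=
  let M : 'M[Rdefinitions.R]_n := map_mx (fun z : int => z%:~R) C in
  \det M != 0 /\
  (exists u : 'cV[Rdefinitions.R]_n, (forall i, 0 < u i 0) /\ (forall i, 0 < (M *m u) i 0)) /\
  (forall v : 'cV[Rdefinitions.R]_n, (forall i, 0 <= (M *m v) i 0) ->
     (forall i, 0 < v i 0) \/ v = 0).

Definition mx_is (n : nat) (M : 'M[int]_n) (l : seq (seq int)) : Prop :=
  size l = n /\ forall i j : 'I_n, M i j = nth 0 (nth [::] l i) j.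

Definition relabel (n : nat) (p : {perm 'I_n}) (C : 'M[int]_n) : 'M[int]_n :=
  \matrix_(i, j) C (p i) (p j).

(* The four cases of Theorem 5.4 for a pair (Cx, Cy) and kappa (1-based count of
   the indices whose rho swaps x and y; these are the indices 0..kappa-1). *)
Definition thm54_cases (n kappa : nat) (Cx Cy : 'M[int]_n) : Prop :=
  (Cx = Cy /\ finite_type Cx /\ indecomposable Cx /\
     forall i j : 'I_n, (nat_of_ord i < kappa)%N -> (kappa <= nat_of_ord j)%N -> Cx i j * Cx j i != 1)
  \/
  (n = 2%N /\ kappa = 1%N /\ exists d : int, (d = -4 \/ d = -5) /\
     mx_is Cx [:: [:: 2; -1]; [:: -3; 2]] /\ mx_is Cy [:: [:: 2; -1]; [:: d; 2]])
  \/
  (n = 3%N /\ kappa = 1%N /\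
     mx_is Cx [:: [:: 2; -1; 0]; [:: -2; 2; -1]; [:: 0; -1; 2]] /\
     mx_is Cy [:: [:: 2; -1; 0]; [:: -2; 2; -2]; [:: 0; -1; 2]])
  \/
  (n = 3%N /\ kappa = 1%N /\
     mx_is Cx [:: [:: 2; -2; 0]; [:: -1; 2; -1]; [:: 0; -1; 2]] /\
     mx_is Cy [:: [:: 2; -2; 0]; [:: -1; 2; -2]; [:: 0; -1; 2]]).

(* Main.v *)
(**
For a set J of indices let s_J^a be the sum of the positive roots at a supported
in J.  As sigma_i permutes the positive roots other than alpha_i,
s_J^{rho_i a} = sigma_i (s_J^a) + 2 alpha_i for i in J.  If rho_i fixes a this says
(C^a s_J^a)_i = 2; if rho_i exchanges x and y, the values (C^x s_J^x)_i and
(C^y s_J^y)_i add up to 4.  It follows that, up to exchanging x and y, C^x maps the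
positive vector s^x to a positive vector, hence is of finite type and its diagram is
a forest of very restricted shape.  The equations for s_J, sign-coherence of the
roots and (R4) for rank two then leave for C^y only the listed possibilities.

Conversely, for a constant Cartan matrix of finite type every positive root descends
to a simple one, so it has bounded length for the invariant positive definite form;
in the exceptional cases an explicit product of reflections makes all simple roots
negative, and each positive root must become simple right before it changes sign.
*)
From Stdlib Require Import Classical.
Require Import Defs.
From HB Require Import structures.
From mathcomp Require Import all_boot all_order all_algebra all_fingroup.
From mathcomp Require Import zify ring lra.
From mathcomp Require Import Rstruct.
Import Order.TTheory GRing.Theory Num.Theory.
Local Open Scope ring_scope.

Set Implicit Arguments.
Unset Strict Implicit.
Unset Printing Implicit Defensive.

(** The vector s_J plays the part of the sum 2 rho of a Weyl group, on which all simple coroots take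
    the value 2. That one object can be chosen as the positive one rests on a rigidity: s_J^y -
    s_J^x is one vector, yet a multiple of [alpha i] for every exchanged [i] in J. So either it is 0
    and all exchanged values are 2, or J contains only one exchanged index; in both cases one object
    has all its values at least 2. The object may depend on J, hence the disjunctions and the
    symmetry in [x] and [y] below.

    The obstacle is that finite type is obtained for one object only. Entries at the other one are
    reached by reflecting its roots across and by solving the linear equations for the two sums.
    Irreducibility, moreover, concerns roots and not matrices; the sum of the positive roots meeting
    both blocks bridges this gap by the same rigidity. *)

Section PositiveVector.
Variables (F : realFieldType) (n : nat) (M : 'M[int]_n).
Hypothesis gM : gcm M.

(** For J the whole index set this is the second clause of [finite_type]. General J allows induction
    on vertices, and a general field serves both [rat] and the reals. *)
Definition positive_on (J : {set 'I_n}) (u : 'I_n -> F) : Prop :=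
  forall i, i \in J -> 0 < u i /\ 0 < \sum_(j in J) (M i j)%:~R * u j.

Lemma gcm_le0 i j : j != i -> (M i j)%:~R <= 0 :> F.
Proof. by case: gM => _ [M0 _] ji; rewrite lerz0 M0 // eq_sym. Qed.

(** The terms dropped from each row are off-diagonal, hence nonpositive. *)
Lemma positive_on_subset (J K : {set 'I_n}) u :
  K \subset J -> positive_on J u -> positive_on K u.
Proof.
move=> KJ uJ i iK; have iJ := subsetP KJ i iK.
have [ui Mui] := uJ i iJ; split=> //.
apply: (lt_le_trans Mui); rewrite (big_setID K) /= (setIidPr KJ) gerDl.
apply: sumr_le0 => j; rewrite inE => /andP[jK jJ].
have [uj _] := uJ j jJ.
rewrite mulr_le0_ge0 ?(ltW uj) ?gcm_le0 //.
by apply: contraNneq jK => ->.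
Qed.

Lemma positive_on_diag (J : {set 'I_n}) u i : i \in J ->
  \sum_(j in J) (M i j)%:~R * u j =
  2 * u i + \sum_(j in J | j != i) (M i j)%:~R * u j :> F.
Proof. by move=> iJ; rewrite (bigD1 i) //=; case: gM => ->. Qed.

(* Minimum principle: subtract from v the largest multiple of u keeping it nonnegative. *)
Lemma positive_on_nonneg (J : {set 'I_n}) u (v : 'I_n -> F) :
  positive_on J u ->
  (forall i, i \in J -> 0 <= \sum_(j in J) (M i j)%:~R * v j) ->
  forall i, i \in J -> 0 <= v i.
Proof.
move=> uJ vJ i0 i0J.
case: (arg_minP (fun i => v i / u i) i0J) => i iJ imin.
have [ui Mui] := uJ i iJ.
suff t0 : 0 <= v i / u i.
  have [ui0 _] := uJ i0 i0J.
  have := le_trans t0 (imin i0 i0J).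
  by rewrite pmulr_lge0 ?invr_gt0.
set t := v i / u i in imin *; rewrite leNgt; apply/negP=> t0.
have vi : v i = t * u i by rewrite /t divfK ?gt_eqF.
have := vJ i iJ; rewrite leNgt => /negP; apply.
have : \sum_(j in J) (M i j)%:~R * (v j - t * u j) <= 0.
  rewrite (positive_on_diag _ iJ) vi subrr mulr0 add0r.
  apply: sumr_le0 => j /andP[jJ ji].
  rewrite mulr_le0_ge0 ?gcm_le0 // subr_ge0 -ler_pdivlMr ?imin //.
  by case: (uJ j jJ).
rewrite (eq_bigr (fun j => (M i j)%:~R * v j - t * ((M i j)%:~R * u j))); last first.
  by move=> j _; rewrite mulrBr; congr (_ - _); rewrite mulrCA.
rewrite sumrB -mulr_sumr subr_le0 => /le_lt_trans; apply.
by rewrite nmulr_rlt0.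
Qed.

(** Row j gives 2 u_j > - M_ji u_i. Multiplied by - M_ij and summed over j, this bounds the sum
    times u_i by twice the off-diagonal part of row i, which is less than 4 u_i. *)
Lemma positive_on_neighbour_sum (J : {set 'I_n}) u i :
  positive_on J u -> i \in J -> \sum_(j in J | j != i) M i j * M j i < 4.
Proof.
move=> uJ iJ; have [ui Mui] := uJ i iJ.
rewrite -(ltr_int F) -(ltr_pM2r ui) rmorph_sum /= mulr_suml.
have : \sum_(j in J | j != i) (M i j * M j i)%:~R * u i <=
       \sum_(j in J | j != i) - (2 * ((M i j)%:~R * u j)).
  apply: ler_sum => j /andP[jJ ji].
  have [uj] := uJ j jJ; rewrite (positive_on_diag _ jJ) (bigD1 i) /=; last first.
    by rewrite iJ eq_sym.
  have : \sum_(k | (k \in J) && (k != j) && (k != i)) (M j k)%:~R * u k <= 0.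
    apply: sumr_le0 => k /andP[/andP[kJ kj] _].
    by have [uk _] := uJ k kJ; rewrite mulr_le0_ge0 ?(ltW uk) ?gcm_le0.
  move: (\sum_(k | _) _) => S S0.
  move=> Muj; rewrite rmorphM /=.
  have := gcm_le0 ji; move: (M i j)%:~R (M j i)%:~R Muj => a b Muj a0.
  nra.
move=> /le_lt_trans; apply.
rewrite sumrN -mulr_sumr.
by move: Mui; rewrite (positive_on_diag _ iJ); lra.
Qed.

(** At an index minimizing u, replacing each u_j by u_i only increases the nonpositive terms of the
    row. *)
Lemma positive_on_leaf (J : {set 'I_n}) u i0 :
  positive_on J u -> i0 \in J ->
  exists2 i, i \in J & -2 < \sum_(j in J | j != i) M i j.
Proof.
move=> uJ i0J; case: (arg_minP u i0J) => i iJ imin; exists i => //.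
have [ui] := uJ i iJ; rewrite (positive_on_diag _ iJ) => Mui.
rewrite -(ltr_int F) -(ltr_pM2r ui) rmorph_sum /= mulr_suml.
have : \sum_(j in J | j != i) (M i j)%:~R * u j <=
       \sum_(j in J | j != i) (M i j)%:~R * u i.
  by apply: ler_sum => j /andP[jJ ji]; rewrite ler_wnM2l ?gcm_le0 ?imin.
by move: Mui; rewrite rmorphN /=; lra.
Qed.

(* A leaf i has at most one neighbour j, and then M i j = -1, so the symmetrizer
   extends by d_i = - d_j M j i. *)
Lemma positive_on_symmetrizable (J : {set 'I_n}) u : positive_on J u ->
  exists d : 'I_n -> int, (forall i, 0 < d i) /\
    forall i j, i \in J -> j \in J -> d i * M i j = d j * M j i.
Proof.
have [Mii [Mle0 M0]] := gM.
move: {2}#|J| (erefl #|J|) => m; elim: m J => [|m IHm] J cJ uJ.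
  exists (fun=> 1); split=> // i j; move/eqP: cJ; rewrite cards_eq0 => /eqP->.
  by rewrite inE.
have [i0 i0J] : exists i, i \in J by apply/card_gt0P; rewrite cJ.
have [i iJ leaf] := positive_on_leaf uJ i0J.
have sub : J :\ i \subset J by apply: subD1set.
have [|d [d0 dM]] := IHm (J :\ i) _ (positive_on_subset sub uJ).
  by move: cJ; rewrite (cardsD1 i) iJ => -[].
have leaf1 (P : pred 'I_n) :
    (forall j, P j -> j != i) -> \sum_(j | P j) M i j <= 0.
  by move=> Pi; apply: sumr_le0 => j /Pi ji; rewrite Mle0 // eq_sym.
have [[j /andP[jJ ji] Mij]|noj] :
    (exists2 j, (j \in J) && (j != i) & M i j != 0) \/
    (forall j, j \in J -> j != i -> M i j = 0).
  case: (pickP [pred j | (j \in J) && (j != i) && (M i j != 0)]) => [j|none].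
    by move=> /= /andP[? ?]; left; exists j.
  right=> j jJ ji; apply/eqP; move: (none j) => /=.
  by rewrite jJ ji /= => /negbFE.
- have Mij1 : M i j = -1 /\ \sum_(k | (k \in J) && (k != i) && (k != j)) M i k = 0.
    have : M i j <= 0 by rewrite Mle0 // eq_sym.
    move: leaf; rewrite (bigD1 j) /=; last by rewrite jJ ji.
    have : \sum_(k | (k \in J) && (k != i) && (k != j)) M i k <= 0.
      by apply: leaf1 => k /andP[/andP[]].
    by move: Mij; move: (M i j) (\sum_(k | _) _) => a S; lia.
  have Mik k : k \in J -> k != i -> k != j -> M i k = 0.
    move=> kJ ki kj; move: Mij1 => [_].
    rewrite (bigD1 k) /=; last by rewrite kJ ki kj.
    have : \sum_(l | (l \in J) && (l != i) && (l != j) && (l != k)) M i l <= 0.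
      by apply: leaf1 => l /andP[/andP[/andP[]]].
    have : M i k <= 0 by rewrite Mle0 // eq_sym.
    by move: (\sum_(l | _) _) => S; lia.
  have Mji : M j i < 0.
    rewrite lt_neqAle Mle0 // andbT; apply: contra Mij => /eqP /M0 ->.
    by [].
  exists (fun k => if k == i then - (d j * M j i) else d k); split=> [k|k l kJ lJ].
    by case: eqP => // _; have := d0 j; nia.
  have main k' : k' \in J -> k' != i ->
      - (d j * M j i) * M i k' = d k' * M k' i.
    move=> k'J k'i; have [->|k'j] := eqVneq k' j.
      by case: Mij1 => ->; lia.
    by rewrite (Mik k') // (M0 _ _ (Mik k' k'J k'i k'j)) !mulr0.
  case: eqP => [->|/eqP ki]; case: eqP => [->|/eqP li] //.
  + exact: main.
  + by rewrite main.
  + by apply: dM; rewrite !inE ?ki ?li.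
- exists (fun k => if k == i then 1 else d k); split=> [k|k l kJ lJ].
    by case: eqP.
  case: eqP => [->|/eqP ki]; case: eqP => [->|/eqP li] //.
  + by rewrite noj // (M0 _ _ (noj l lJ li)) !mulr0.
  + by rewrite noj // (M0 _ _ (noj k kJ ki)) !mulr0.
  + by apply: dM; rewrite !inE ?ki ?li.
Qed.

End PositiveVector.

Lemma sum_setT (V : nmodType) (T : finType) (f : T -> V) :
  \sum_(i in [set: T]) f i = \sum_i f i.
Proof. by apply: eq_bigl => i; rewrite in_setT. Qed.

Lemma finite_type_positive n (M : 'M[int]_n) : finite_type M ->
  exists u : 'I_n -> Rdefinitions.R, positive_on M [set: 'I_n] u.
Proof.
move=> [_ [[u [u0 Mu0]] _]]; exists (fun i => u i 0) => i _; split=> //.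
have := Mu0 i; rewrite mxE; congr (_ < _).
by rewrite sum_setT; apply: eq_bigr => j _; rewrite mxE.
Qed.

(** Everything follows from the minimum principle: a kernel vector and its opposite are both
    nonnegative, and the zero set of a nonnegative v with M v >= 0 splits off from its
    complement. *)
Lemma positive_finite_type n (M : 'M[int]_n) (u : 'I_n -> Rdefinitions.R) :
  gcm M -> indecomposable M -> positive_on M [set: 'I_n] u -> finite_type M.
Proof.
move=> gM indM uM; set N := map_mx (fun z : int => z%:~R) M : 'M[Rdefinitions.R]_n.
have NE (v : 'cV[Rdefinitions.R]_n) i : (N *m v) i 0 = \sum_(j in [set: 'I_n]) (M i j)%:~R * v j 0.
  by rewrite sum_setT mxE; apply: eq_bigr => j _; rewrite mxE.
have nonneg_of (v : 'cV[Rdefinitions.R]_n) : (forall i, 0 <= (N *m v) i 0) -> forall i, 0 <= v i 0.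
  move=> Nv i; apply: (positive_on_nonneg gM uM (v := fun i => v i 0)) => // k _.
  have := Nv k. by rewrite NE.
split; first last.
  split=> [|v Nv].
    exists (\col_i u i); split=> i; first by rewrite mxE; case: (uM i).
    have [_] := uM i (in_setT i); rewrite NE; congr (_ < _).
    by apply: eq_bigr => j _; rewrite !mxE.
  have v0 := nonneg_of v Nv.
  have [->|] := eqVneq v 0; first by right.
  move=> vn0; left=> i; rewrite lt_neqAle v0 andbT eq_sym.
  apply: contra_notN indM => vi0; exists [set k | v k 0 == 0]; split; last split.
  - by apply/set0Pn; exists i; rewrite inE.
  - apply: contraNneq vn0 => allZ; apply/eqP/matrixP=> k l; rewrite ord1 mxE.
    have : k \notin ~: [set k0 | v k0 0 == 0] by rewrite allZ inE.
    by rewrite !inE negbK => /eqP.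
  - move=> k l; rewrite !inE => /eqP vk vl.
    have := Nv k; rewrite NE (positive_on_diag gM) // vk mulr0 add0r.
    rewrite (bigD1 l) /=; last by rewrite inE; apply: contraNneq vl => ->; rewrite vk.
    have lk : l != k by apply: contraNneq vl => ->; rewrite vk.
    set S := (X in 0 <= _ + X).
    have S0 : S <= 0.
      apply: sumr_le0 => j /andP[/andP[_ jk] _].
      by rewrite mulr_le0_ge0 ?v0 // gcm_le0.
    have vl0 : 0 < v l 0 by rewrite lt_neqAle v0 andbT eq_sym.
    have := gcm_le0 Rdefinitions.R gM lk => Mkl H.
    have : 0 <= (M k l)%:~R * v l 0 by lra.
    rewrite pmulr_lge0 // => Mkl'.
    by apply/eqP; rewrite -(intr_eq0 Rdefinitions.R) eq_le Mkl Mkl'.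
apply/negP; rewrite -det_tr => /det0P[w wn0 wN].
have Nw : N *m w^T = 0 by rewrite -[N]trmxK -trmx_mul wN trmx0.
case/negP: wn0; apply/eqP/matrixP=> i j; rewrite ord1 mxE.
have := nonneg_of w^T; have := nonneg_of (- w^T).
rewrite mulmxN Nw oppr0 => H1 H2; apply/eqP; rewrite eq_le.
have {}H1 := H1 _ j; have {}H2 := H2 _ j; rewrite !mxE in H1 H2.
by rewrite H2 ?andbT -1?oppr_ge0 ?H1 // => k; rewrite mxE.
Qed.

Definition pairing n (M : 'M[int]_n) (i : 'I_n) (v : 'rV[int]_n) : int :=
  \sum_j M i j * v 0 j.

Lemma alphaE n (i j : 'I_n) : (alpha i : 'rV[int]_n) 0 j = (j == i)%:R.
Proof. by rewrite mxE. Qed.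

Lemma pairingD n M (i : 'I_n) v w : pairing M i (v + w) = pairing M i v + pairing M i w.
Proof. by rewrite -big_split; apply: eq_bigr => j _; rewrite mxE mulrDr. Qed.

Lemma pairingZ n M (i : 'I_n) c v : pairing M i (c *: v) = c * pairing M i v.
Proof. by rewrite mulr_sumr; apply: eq_bigr => j _; rewrite mxE mulrCA. Qed.

Lemma pairingN n M (i : 'I_n) v : pairing M i (- v) = - pairing M i v.
Proof. by rewrite -scaleN1r pairingZ mulN1r. Qed.

Lemma pairing_alpha n M (i j : 'I_n) : pairing M i (alpha j) = M i j.
Proof.
rewrite /pairing (bigD1 j) //= alphaE eqxx mulr1 big1 ?addr0 // => k kj.
by rewrite alphaE (negPf kj) mulr0.
Qed.

(** * The invariant form of a symmetrizable matrix *)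

Section Form.
Variables (n : nat) (M : 'M[int]_n) (d : 'I_n -> int).
Hypothesis gM : gcm M.
Hypothesis dM : forall i j, d i * M i j = d j * M j i.

(** Its Gram matrix is diag(d) M, so [alpha i] has square length 2 d_i. *)
Definition cartan_form (v w : 'rV[int]_n) : int := \sum_i v 0 i * d i * pairing M i w.

Lemma cartan_form_sym v w : cartan_form v w = cartan_form w v.
Proof.
have formE a b : cartan_form a b = \sum_i \sum_j a 0 i * b 0 j * (d i * M i j).
  apply: eq_bigr => i _; rewrite mulr_sumr; apply: eq_bigr => j _; ring.
rewrite !formE exchange_big; apply: eq_bigr => i _; apply: eq_bigr => j _.
by rewrite dM; ring.
Qed.

Lemma cartan_form_subr v w z : cartan_form v (w - z) = cartan_form v w - cartan_form v z.
Proof.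
rewrite -sumrB; apply: eq_bigr => i _.
by rewrite pairingD pairingN mulrBr.
Qed.

Lemma cartan_form_scaler v c w : cartan_form v (c *: w) = c * cartan_form v w.
Proof. by rewrite mulr_sumr; apply: eq_bigr => i _; rewrite pairingZ mulrCA. Qed.

Lemma cartan_form_alphal i w : cartan_form (alpha i) w = d i * pairing M i w.
Proof.
rewrite /cartan_form (bigD1 i) //= alphaE eqxx mul1r big1 ?addr0 // => k ki.
by rewrite alphaE (negPf ki) !mul0r.
Qed.

Lemma cartan_form_reflection i v :
  let w := v - pairing M i v *: alpha i in cartan_form w w = cartan_form v v.
Proof.
rewrite /= cartan_form_subr cartan_form_scaler [cartan_form _ v]cartan_form_sym.
rewrite [cartan_form _ (alpha i)]cartan_form_sym !cartan_form_subr !cartan_form_scaler.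
rewrite !cartan_form_alphal [cartan_form v (alpha i)]cartan_form_sym.
rewrite cartan_form_alphal pairing_alpha.
by have [-> _] := gM; ring.
Qed.

(* With S = diag(d) M and x_i = v_i / u_i: for i <> j,
   S_ij v_i v_j >= S_ij u_i u_j (x_i^2 + x_j^2) / 2, because S_ij <= 0. *)
Lemma cartan_form_bound (F : realFieldType) (u : 'I_n -> F) (v : 'rV[int]_n) i :
  (forall i, 0 < d i) -> positive_on M [set: 'I_n] u ->
  ((v 0 i)%:~R) ^+ 2 * ((d i)%:~R * \sum_j (M i j)%:~R * u j) <=
  (cartan_form v v)%:~R * u i.
Proof.
move=> d0 uM; have u0 k : 0 < u k by case: (uM k).
have Mu0 k : 0 < \sum_j (M k j)%:~R * u j.
  by case: (uM k (in_setT k)) => _; rewrite sum_setT.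
pose x k : F := (v 0 k)%:~R / u k.
have vx k : (v 0 k)%:~R = x k * u k by rewrite /x divfK // gt_eqF.
pose S k l : F := (d k * M k l)%:~R.
have SC k l : S k l = S l k by rewrite /S dM.
pose Su k := \sum_l S k l * u l.
have SuE k : Su k = (d k)%:~R * \sum_j (M k j)%:~R * u j.
  by rewrite mulr_sumr; apply: eq_bigr => j _; rewrite /S rmorphM /= mulrA.
have Su0 k : 0 < Su k by rewrite SuE mulr_gt0 // ltr0z.
rewrite -SuE.
have : \sum_k x k ^+ 2 * (u k * Su k) <= (cartan_form v v)%:~R.
  have -> : \sum_k x k ^+ 2 * (u k * Su k) =
      \sum_k \sum_l S k l * (u k * u l) * ((x k ^+ 2 + x l ^+ 2) / 2).
    transitivity (\sum_k \sum_l (S k l * (u k * u l) * (x k ^+ 2 / 2) +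
                                 S k l * (u k * u l) * (x l ^+ 2 / 2))).
      under [RHS]eq_bigr do rewrite big_split.
      rewrite big_split /= [X in _ = _ + X]exchange_big /= -big_split /=.
      apply: eq_bigr => k _; rewrite -big_split /= /Su mulr_sumr mulr_sumr.
      by apply: eq_bigr => l _; rewrite (SC l k); field.
    by apply: eq_bigr => k _; apply: eq_bigr => l _; field.
  rewrite /cartan_form rmorph_sum /=; apply: ler_sum => k _.
  rewrite !rmorphM rmorph_sum /= mulr_sumr; apply: ler_sum => l _.
  rewrite !rmorphM /= !vx /S rmorphM /=.
  have [->|lk] := eqVneq l k; first by rewrite le_eqVlt; apply/orP; left; apply/eqP; field.
  have := gcm_le0 F gM lk; have : (0 : F) < (d k)%:~R by rewrite ltr0z.
  move: (d k)%:~R (M k l)%:~R (u k) (u l) (u0 k) (u0 l) => D m uk ul uk0 ul0 D0 m0.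
  have H : D * m * (uk * ul) <= 0.
    by rewrite mulr_le0_ge0 ?(mulr_ge0 (ltW uk0) (ltW ul0)) // mulr_ge0_le0 // ltW.
  have := sqr_ge0 (x k - x l); move: H (x k) (x l) => H a b ab.
  have -> : a * uk * D * (m * (b * ul)) = D * m * (uk * ul) * (a * b) by ring.
  by rewrite ler_wnM2l //; lra.
rewrite (bigD1 i) //= => le_form.
have : x i ^+ 2 * (u i * Su i) <= (cartan_form v v)%:~R.
  apply: le_trans le_form; rewrite lerDl; apply: sumr_ge0 => k _.
  by rewrite mulr_ge0 ?sqr_ge0 // mulr_ge0 // ltW.
rewrite -(ler_pM2r (u0 i)); congr (_ <= _).
by rewrite vx; ring.
Qed.

End Form.

Lemma bounded_vectors n (K : nat) : exists s : seq 'rV[int]_n,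
  forall v : 'rV[int]_n, (forall j, `|v 0 j| <= K%:Z) -> v \in s.
Proof.
exists [seq map_mx (fun k : 'I_(K + K).+1 => k%:Z - K%:Z) w | w : 'rV['I_(K + K).+1]_n].
move=> v vK; apply/mapP.
exists (\row_j inord (absz (v 0 j + K%:Z))); first by rewrite mem_enum.
apply/matrixP=> i j; rewrite ord1 !mxE.
by move: (vK j); move: (v 0 j) => z zK; rewrite inordK; lia.
Qed.

(** * Root systems *)

(* lia mistreats the index 0 : 'I_1 inside row-vector coordinates. *)
Ltac coord_lia :=
  repeat match goal with
    H : context [@fun_of_matrix _ 1 _ ?v ?i ?j] |- _ => revert H end;
  repeat match goal with
    |- context [@fun_of_matrix ?T 1 ?n ?v ?i ?j] =>
      move: (@fun_of_matrix T 1 n v i j : int) => ? end;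
  lia.

Lemma nonneg_antisym n (v : 'rV[int]_n) : nonneg v -> nonneg (- v) -> v = 0.
Proof.
move=> v0 Nv0; apply/matrixP=> i j; rewrite ord1 mxE.
by have := Nv0 j; rewrite mxE; have := v0 j; coord_lia.
Qed.

Lemma alpha_nonneg n (i : 'I_n) : nonneg (alpha i).
Proof. by move=> j; rewrite alphaE ler0n. Qed.

Section RootSystem.
Variables (n : nat) (A : Type) (rho : 'I_n -> A -> A).
Variables (C : A -> 'M[int]_n) (R : A -> 'rV[int]_n -> Prop).
Hypothesis RS : root_system rho C R.

Lemma rs_gcm a : gcm (C a).
Proof. by case: RS => [[]]. Qed.

Lemma rhoK i a : rho i (rho i a) = a.
Proof. by case: RS => [[_ []]]. Qed.

Lemma cartan_rho a i j : C (rho i a) i j = C a i j.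
Proof. by case: RS => [[_ []]]. Qed.

Lemma sigmaE i a v : sigma C i a v = v - pairing (C a) i v *: alpha i.
Proof. by []. Qed.

Lemma sigma_other i a v j : j != i -> sigma C i a v 0 j = v 0 j.
Proof. by move=> ji; rewrite !mxE (negPf ji) mulr0 subr0. Qed.

Lemma sigma_self i a v : sigma C i a v 0 i = v 0 i - pairing (C a) i v.
Proof. by rewrite !mxE !eqxx mulr1. Qed.

Lemma sigmaD i a v w : sigma C i a (v + w) = sigma C i a v + sigma C i a w.
Proof. by rewrite !sigmaE pairingD scalerDl opprD addrACA. Qed.

Lemma sigmaZ i a c v : sigma C i a (c *: v) = c *: sigma C i a v.
Proof. by rewrite !sigmaE pairingZ scalerBr scalerA. Qed.

Lemma sigma0 i a : sigma C i a 0 = 0.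
Proof. by rewrite -(scale0r 0) sigmaZ !scale0r. Qed.

Lemma pairing_rho a i v : pairing (C (rho i a)) i v = pairing (C a) i v.
Proof. by apply: eq_bigr => j _; rewrite cartan_rho. Qed.

Lemma sigma_alpha i a : sigma C i a (alpha i) = - alpha i.
Proof.
rewrite sigmaE pairing_alpha; have [-> _] := rs_gcm a.
by rewrite scaler_nat mulr2n opprD addNKr.
Qed.

Lemma sigmaK i a v : sigma C i (rho i a) (sigma C i a v) = v.
Proof.
rewrite (sigmaE i a) -scaleNr sigmaD sigmaZ sigma_alpha sigmaE pairing_rho.
by rewrite scalerN scaleNr opprK addrNK.
Qed.

Lemma root_sigma i a v : R a v -> R (rho i a) (sigma C i a v).
Proof. by case: RS => _ [_ [_ [H _]]] Rv; apply/H; exists v. Qed.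

Lemma root_sign a v : R a v -> nonneg v \/ nonneg (- v).
Proof. by case: RS => _ [H _] /H[[]|[]]; [left|right]. Qed.

Lemma root_opp a v : R a v -> R a (- v).
Proof.
case: RS => _ [H _] Rv; have [[_ v0]|[]//] := (H a v).1 Rv.
by apply/H; right; rewrite opprK.
Qed.

Lemma root_alpha a i : R a (alpha i).
Proof. by case: RS => _ [_ [H _]]; case: ((H a i _).2 (or_introl erefl)). Qed.

Lemma root_scale_alpha a i k : R a (k *: alpha i) -> k = 1 \/ k = -1.
Proof.
case: RS => _ [_ [H _]] Rv; have := (H a i _).1 (conj Rv (ex_intro _ k erefl)).
by case=> /matrixP/(_ 0 i); rewrite !mxE !eqxx mulr1; [left|right].
Qed.

Lemma root_support1 a v i : R a v -> nonneg v ->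
  (forall j, j != i -> v 0 j = 0) -> v = alpha i.
Proof.
move=> Rv v0 vi; have vE : v = v 0 i *: alpha i.
  apply/matrixP=> k j; rewrite ord1 !mxE eqxx /=.
  by have [->|/vi->] := eqVneq j i; rewrite ?mulr1 ?mulr0.
have [] := @root_scale_alpha a i (v 0 i); first by rewrite -vE.
  by move=> v1; rewrite vE v1 scale1r.
by move=> v1; have := v0 i; rewrite v1.
Qed.

Lemma root_neq0 (i : 'I_n) a : ~ R a 0.
Proof. by rewrite -(scale0r (alpha i)) => /root_scale_alpha[]. Qed.

(** Only coordinate i changes, so a sign change would force all other coordinates of v to vanish. *)
Lemma root_sigma_nonneg i a v :
  R a v -> nonneg v -> v <> alpha i -> nonneg (sigma C i a v).
Proof.
move=> Rv v0 vi; have [//|sv] := root_sign (root_sigma i Rv).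
case: vi; apply: (root_support1 Rv v0) => j ji.
by have := sv j; rewrite mxE sigma_other //; have := v0 j; coord_lia.
Qed.

Lemma root_mixed a v i j : R a v -> 0 < v 0 i -> v 0 j < 0 -> False.
Proof. by move=> /root_sign[/(_ j)|/(_ i)]; rewrite ?mxE; coord_lia. Qed.

(** The image of [alpha j] under the reflection arriving from [rho i a]: a root from which the entry
    of C can be read off. *)
Lemma root_string_end a i j : R a (alpha j - C a i j *: alpha i).
Proof.
have := root_sigma i (root_alpha (rho i a) j).
by rewrite rhoK sigmaE pairing_rho pairing_alpha.
Qed.

(** Reflection at i turns the coefficient m into - C_ij - m, while coordinate j stays 1. *)
Lemma root_string_le a i j m : i != j ->
  R a (alpha j + m *: alpha i) -> m <= - C a i j.
Proof.
move=> ij /(root_sigma i) Rs; rewrite leNgt; apply/negP=> mC.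
apply: (root_mixed (i := j) (j := i) Rs).
  by rewrite sigma_other 1?eq_sym // !mxE !eqxx eq_sym (negPf ij) mulr0.
rewrite sigma_self pairingD pairingZ !pairing_alpha !mxE !eqxx (negPf ij) /=.
by have [-> _] := rs_gcm a; lia.
Qed.

Definition positive_roots (P : 'rV[int]_n -> Prop) (a : A) (s : seq 'rV[int]_n) :=
  uniq s /\ forall v, v \in s <-> R a v /\ nonneg v /\ P v.

(** [R] and [P] are undecidable predicates, so the bounding list is filtered by excluded middle. *)
Lemma positive_roots_exist P a : finite_rs R -> exists s, positive_roots P a s.
Proof.
move=> /(_ a)[t tR].
have [s [us sE]] : exists s, uniq s /\
    forall v, v \in s <-> v \in t /\ R a v /\ nonneg v /\ P v.
  elim: t {tR} => [|w t [s [us sE]]]; first by exists [::]; split=> // v; split=> // -[].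
  have [Pw|nPw] := classic (R a w /\ nonneg w /\ P w); last first.
    exists s; split=> // v; rewrite sE inE; split=> [[-> ?]|[/orP[/eqP->|]]] //.
    by rewrite orbT.
  have [ws|ws] := boolP (w \in s).
    exists s; split=> // v; rewrite sE inE; split=> [[-> ?]|[/orP[/eqP->|]]] //.
      by rewrite orbT.
    by move=> _; apply/sE.
  exists (w :: s); rewrite /= ws us; split=> // v; rewrite !inE; split.
    by case/orP=> [/eqP->|/sE[-> ?]]; rewrite ?eqxx ?orbT.
  by case=> /orP[->//|vt Pv]; apply/orP; right; apply/sE.
exists s; split=> // v; rewrite sE; split=> [[]//|[Rv ?]]; split=> //; exact: tR.
Qed.

(** The two conditions make [sigma] a bijection between the selected roots at both objects. The
    instances are the roots in a span other than [alpha i], and the roots meeting both blocks. *)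
Lemma positive_roots_sigma P Q i a s t :
  positive_roots P a s -> positive_roots Q (rho i a) t ->
  (forall v, R a v -> nonneg v -> P v -> v <> alpha i /\ Q (sigma C i a v)) ->
  (forall v, R (rho i a) v -> nonneg v -> Q v ->
     v <> alpha i /\ P (sigma C i (rho i a) v)) ->
  \sum_(v <- t) v = sigma C i a (\sum_(v <- s) v).
Proof.
move=> [us sE] [ut tE] PQ QP.
have -> : sigma C i a (\sum_(v <- s) v) = \sum_(v <- s) sigma C i a v.
  by elim: (s) => [|w r IH]; rewrite ?big_nil ?sigma0 // !big_cons sigmaD IH.
rewrite -(big_map (sigma C i a) xpredT (fun v => v)); apply: perm_big.
apply: uniq_perm => //.
  rewrite map_inj_uniq // => v w vw.
  by rewrite -(sigmaK i a v) vw sigmaK.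
move=> v; apply/idP/idP=> [/tE[Rv [v0 Qv]]|/mapP[w /sE[Rw [w0 Pw]] ->]].
  have [vi Pv] := QP v Rv v0 Qv.
  apply/mapP; exists (sigma C i (rho i a) v); last by rewrite -{1}(rhoK i a) sigmaK.
  have := root_sigma i Rv; rewrite rhoK => Rsv.
  by apply/sE; split=> //; split=> //; apply: root_sigma_nonneg.
have [wi Qw] := PQ w Rw w0 Pw.
apply/tE; split; first exact: root_sigma.
by split=> //; apply: root_sigma_nonneg.
Qed.

Lemma positive_roots_rem (P : 'rV[int]_n -> Prop) i a s : P (alpha i) ->
  positive_roots P a s ->
  positive_roots (fun v => P v /\ v <> alpha i) a (rem (alpha i) s) /\
  \sum_(v <- s) v = alpha i + \sum_(v <- rem (alpha i) s) v.
Proof.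
move=> Pi [us sE]; split; last first.
  apply: big_rem; apply/sE; split; first exact: root_alpha.
  by split=> //; apply: alpha_nonneg.
split=> [|v]; first exact: rem_uniq.
rewrite mem_rem_uniq // inE; split.
  by case/andP=> /eqP vi /sE[Rv [v0 Pv]].
by case=> Rv [v0 [Pv /eqP vi]]; rewrite vi; apply/sE.
Qed.

Definition parabolic_sum (J : {set 'I_n}) (a : A) (w : 'rV[int]_n) :=
  exists2 s, positive_roots (in_span J) a s & w = \sum_(v <- s) v.

Lemma alpha_in_span (J : {set 'I_n}) i : i \in J -> in_span J (alpha i).
Proof.
by move=> iJ j jJ; rewrite alphaE; case: eqP => // ji; rewrite ji iJ in jJ.
Qed.

Lemma sigma_in_span (J : {set 'I_n}) i a v : i \in J -> in_span J v ->
  in_span J (sigma C i a v).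
Proof.
move=> iJ vJ j jJ; rewrite sigma_other ?vJ //.
by apply: contraNneq jJ => ->.
Qed.

Lemma parabolic_sum_exists J a : finite_rs R -> exists w, parabolic_sum J a w.
Proof.
by move=> fR; have [s sP] := positive_roots_exist (in_span J) a fR; eexists; exists s.
Qed.

Lemma parabolic_sum_gt0 (J : {set 'I_n}) a w i : parabolic_sum J a w -> i \in J -> 0 < w 0 i.
Proof.
move=> [s sP ->] iJ.
have [[_ sE] ->] := positive_roots_rem (alpha_in_span iJ) sP.
rewrite mxE alphaE eqxx summxE; apply: ltr_wpDr => //.
rewrite big_seq; apply: sumr_ge0 => v vs.
by have [_ [v0 _]] := (sE v).1 vs; apply: v0.
Qed.

Lemma parabolic_sum_eq0 (J : {set 'I_n}) a w i : parabolic_sum J a w -> i \notin J -> w 0 i = 0.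
Proof.
move=> [s [_ sE] ->] iJ; rewrite summxE big_seq big1 // => v vs.
by have [_ [_ vJ]] := (sE v).1 vs; apply: vJ.
Qed.

Lemma parabolic_sum_sigma (J : {set 'I_n}) a i w w' : i \in J ->
  parabolic_sum J a w -> parabolic_sum J (rho i a) w' ->
  w' = sigma C i a w + 2%:R *: alpha i.
Proof.
move=> iJ [s sP ->] [t tP ->].
have [sP' ->] := positive_roots_rem (alpha_in_span iJ) sP.
have [tP' ->] := positive_roots_rem (alpha_in_span iJ) tP.
rewrite (positive_roots_sigma sP' tP').
- by rewrite sigmaD sigma_alpha addrAC scaler_nat mulr2n addKr.
- move=> v Rv v0 [vJ vi]; split=> //; split; first exact: sigma_in_span.
  move=> svi; have := v0 i; have := sigmaK i a v.
  by rewrite svi sigma_alpha => <-; rewrite mxE alphaE eqxx.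
- move=> v Rv v0 [vJ vi]; split=> //; split; first exact: sigma_in_span.
  move=> svi; have := v0 i; have := sigmaK i (rho i a) v.
  by rewrite svi sigma_alpha => <-; rewrite mxE alphaE eqxx.
Qed.

Fixpoint walk (a : A) (w : seq 'I_n) (v : 'rV[int]_n) : 'rV[int]_n :=
  if w is i :: w' then walk (rho i a) w' (sigma C i a v) else v.

Lemma walkD a w u v : walk a w (u + v) = walk a w u + walk a w v.
Proof. by elim: w a u v => //= i w IH a u v; rewrite sigmaD IH. Qed.

Lemma walkZ a w c v : walk a w (c *: v) = c *: walk a w v.
Proof. by elim: w a v => //= i w IH a v; rewrite sigmaZ IH. Qed.

Lemma root_walk a w v : R a v -> exists b, R b (walk a w v).
Proof.
elim: w a v => [|i w IH] a v Rv /=; first by exists a.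
exact: (IH _ _ (root_sigma i Rv)).
Qed.

(* A positive root which the walk makes negative equals, when it changes sign, the
   simple root being reflected. *)
Lemma positive_root_walk a w : exists s : seq 'rV[int]_n,
  forall v, R a v -> nonneg v -> v \in s \/ nonneg (walk a w v).
Proof.
elim: w a => [|i w IH] a; first by exists [::] => v _ v0; right.
have [s sP] := IH (rho i a).
exists (alpha i :: map (sigma C i (rho i a)) s) => v Rv v0; rewrite inE.
have [->|/eqP vi] := eqVneq v (alpha i); first by left.
have [svs|?] := sP _ (root_sigma i Rv) (root_sigma_nonneg Rv v0 vi); last by right.
by left; apply/mapP; exists (sigma C i a v); rewrite ?sigmaK.
Qed.

Lemma finite_positive_roots a (s : seq 'rV[int]_n) :
  (forall v, R a v -> nonneg v -> v \in s) ->
  exists t : seq 'rV[int]_n, forall v, R a v -> v \in t.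
Proof.
move=> sP; exists (s ++ map -%R s) => v Rv; rewrite mem_cat.
have [v0|v0] := root_sign Rv; first by rewrite sP.
apply/orP; right; apply/mapP; exists (- v); last by rewrite opprK.
by apply: sP => //; apply: root_opp.
Qed.

(** A positive root outside the list of [positive_root_walk] would have an image both nonnegative
    and nonpositive, so 0 would be a root. *)
Lemma finite_walk (i0 : 'I_n) a w : (forall j, nonneg (- walk a w (alpha j))) ->
  exists s : seq 'rV[int]_n, forall v, R a v -> v \in s.
Proof.
move=> wneg; have [s sP] := positive_root_walk a w.
apply: (@finite_positive_roots a s) => v Rv v0.
have [//|wv0] := sP v Rv v0.
have [b Rb] := root_walk w Rv.
have nwv : nonneg (- walk a w v).
  have -> : v = \sum_j v 0 j *: alpha j by exact: row_sum_delta.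
  have : forall j, 0 <= v 0 j by [].
  move: (v 0) => c c0.
  elim/big_ind: _ => [|x y x0 y0|j _].
  - by rewrite -(scale0r 0) walkZ scale0r oppr0 => j; rewrite mxE.
  - by rewrite walkD opprD => j; rewrite mxE addr_ge0 ?x0 ?y0.
  - by rewrite walkZ -scalerN => k; rewrite mxE mulr_ge0 ?wneg.
have wv := nonneg_antisym wv0 nwv.
by case: (@root_neq0 i0 b); rewrite -wv.
Qed.

Lemma finite_rho a i :
  (exists s : seq 'rV[int]_n, forall v, R a v -> v \in s) ->
  exists s : seq 'rV[int]_n, forall v, R (rho i a) v -> v \in s.
Proof.
case=> s sP; exists (map (sigma C i a) s) => v Rv.
apply/mapP; exists (sigma C i (rho i a) v); last by rewrite -{1}(rhoK i a) sigmaK.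
by apply: sP; rewrite -{1}(rhoK i a); apply: root_sigma.
Qed.

End RootSystem.

(** * Finiteness and irreducibility criteria for the converse *)

Section Finiteness.
Variables (n : nat) (A : Type) (rho : 'I_n -> A -> A).
Variables (C : A -> 'M[int]_n) (R : A -> 'rV[int]_n -> Prop).
Hypothesis RS : root_system rho C R.

Section ConstantMatrix.
Variables (M : 'M[int]_n) (F : archiRealFieldType) (u : 'I_n -> F) (i0 : 'I_n).
Hypothesis CM : forall a, C a = M.
Hypothesis uM : positive_on M [set: 'I_n] u.

(** Otherwise M (- v) >= 0, and the minimum principle makes - v nonnegative. *)
Lemma positive_root_descent a v : R a v -> nonneg v ->
  exists i, 0 < pairing M i v.
Proof.
move=> Rv v0; apply: NNPP => noi.
have gM : gcm M by rewrite -(CM a); apply: (rs_gcm RS).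
have Nv0 : nonneg (- v).
  move=> j; rewrite mxE -(ler_int F).
  apply: (positive_on_nonneg gM uM (v := fun i => (- v 0 i)%:~R)) => // i _.
  rewrite sum_setT.
  have -> : \sum_j (M i j)%:~R * (- v 0 j)%:~R = (- pairing M i v)%:~R :> F.
    rewrite -sumrN rmorph_sum; apply: eq_bigr => k _.
    by rewrite -rmorphM mulrN.
  by rewrite ler0z oppr_ge0 leNgt; apply/negP=> Mv; apply: noi; exists i.
by apply: (root_neq0 RS i0 (a := a)); rewrite -(nonneg_antisym v0 Nv0).
Qed.

(** Induction on the height: reflecting at an i with positive pairing lowers it and keeps the form,
    which is common to all objects. *)
Lemma positive_root_form (d : 'I_n -> int) a v :
  (forall i j, d i * M i j = d j * M j i) ->
  R a v -> nonneg v -> exists i, cartan_form M d v v = 2 * d i.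
Proof.
move=> dM.
have gM : gcm M by rewrite -(CM a); apply: (rs_gcm RS).
have [m] := ubnP (absz (\sum_j v 0 j)).
elim: m a v => // m IH a v hm Rv v0.
have [i Mi] := positive_root_descent Rv v0.
have [->|/eqP vi] := eqVneq v (alpha i).
  by exists i; rewrite cartan_form_alphal pairing_alpha; have [-> _] := gM; rewrite mulrC.
have sv0 := root_sigma_nonneg RS Rv v0 vi.
have sE : sigma C i a v = v - pairing M i v *: alpha i by rewrite sigmaE CM.
have [|j fj] := IH (rho i a) (sigma C i a v) _ (root_sigma RS i Rv) sv0; last first.
  by exists j; rewrite -fj sE cartan_form_reflection.
have : \sum_j sigma C i a v 0 j = \sum_j v 0 j - pairing M i v.
  transitivity (\sum_j v 0 j - \sum_j pairing M i v * (alpha i : 'rV[int]_n) 0 j).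
    by rewrite -sumrB; apply: eq_bigr => j _; rewrite sE !mxE.
  congr (_ - _); rewrite (bigD1 i) //= alphaE eqxx mulr1 big1 ?addr0 // => j ji.
  by rewrite alphaE (negPf ji) mulr0.
have : 0 <= \sum_j sigma C i a v 0 j by apply: sumr_ge0 => j _; apply: sv0.
have : 0 <= \sum_j v 0 j by apply: sumr_ge0 => j _; apply: v0.
move: hm Mi.
move: (\sum_j v 0 j : int) (\sum_j sigma C i a v 0 j : int) (pairing M i v) => s t p.
lia.
Qed.

Lemma finite_positive : finite_rs R.
Proof.
move=> a; have gM : gcm M by rewrite -(CM a); apply: (rs_gcm RS).
have [d [d0 dM']] := positive_on_symmetrizable gM uM.
have dM i j : d i * M i j = d j * M j i by apply: dM'; rewrite inE.
pose D := \sum_i 2 * d i.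
pose Mu i := (d i)%:~R * \sum_j (M i j)%:~R * u j.
have Mu0 i : 0 < Mu i.
  rewrite mulr_gt0 ?ltr0z //.
  by have [_] := uM (in_setT i); rewrite sum_setT.
have u0 i : 0 < u i by have [] := uM (in_setT i).
(* [cartan_form_bound] solved for the square of coordinate i, with the form replaced by [D], which
   dominates every 2 d_i. *)
pose B i := D%:~R * u i / Mu i.
have D0 : 0 <= D by apply: sumr_ge0 => i _; rewrite mulr_ge0 // ltW.
have B0 i : 0 <= B i 
  by apply: divr_ge0 (ltW (Mu0 i)); apply: mulr_ge0 (ltW (u0 i)); rewrite ler0z.
pose K := (\sum_i Num.bound (B i))%N.
have [s sK] := bounded_vectors n K.
apply: (finite_positive_roots RS (s := s)) => v Rv v0; apply: sK => j.
have [i fi] := positive_root_form dM Rv v0.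
have fD : cartan_form M d v v <= D.
  rewrite fi /D (bigD1 i) //= lerDl; apply: sumr_ge0 => k _.
  by rewrite mulr_ge0 // ltW.
have vB : (v 0 j)%:~R ^+ 2 <= B j.
  rewrite ler_pdivlMr //; apply: (le_trans (cartan_form_bound gM dM v j d0 uM)).
  by rewrite ler_pM2r // ler_int.
have vbound : v 0 j <= (Num.bound (B j))%:Z.
  rewrite -(ler_int F) ltW //; apply: le_lt_trans (archi_boundP (B0 j)).
  (* A natural number is at most its square. *)
  apply: le_trans vB; rewrite -rmorphXn ler_int.
  have := v0 j; move: (v 0 j : int) => z; nia.
rewrite ger0_norm ?v0 //; apply: (le_trans vbound).
by rewrite lez_nat /K (bigD1 j) //= leq_addr.
Qed.

End ConstantMatrix.

(** For i in I1 and j outside, the root [alpha j - C a i j *: alpha i] has coordinate 1 at j, so it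
    lies in the span of I2 and its coordinate at i vanishes. *)
Lemma reducible_decomposable a : reducible R ->
  exists I1 : {set 'I_n}, I1 != set0 /\ ~: I1 != set0 /\
    forall i j, i \in I1 -> j \notin I1 -> C a i j = 0.
Proof.
move=> [I1 [I2 [I1n [I2n [dis [un RI]]]]]]; exists I1; split=> //.
have I12 : I2 \subset ~: I1 by rewrite -disjoints_subset disjoint_sym.
have I2E j : j \notin I1 -> j \in I2.
  by move=> j1; have := in_setT j; rewrite -un inE (negPf j1).
split.
  apply: contraNneq I2n => I1c; move: I12; rewrite I1c subset0; exact.
move=> i j i1 j1; have ij : j != i by apply: contraNneq j1 => ->.
have i2 : i \notin I2 by apply/negP=> /(subsetP I12); rewrite inE i1.
have [[_ /(_ j j1)]|[_ /(_ i i2)]] := (RI a _).1 (root_string_end RS a i j).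
  by rewrite !mxE !eqxx (negPf ij) mulr0 subr0.
by rewrite !mxE !eqxx eq_sym (negPf ij) sub0r mulr1 => /eqP; rewrite oppr_eq0 => /eqP.
Qed.

(** Coordinates with respect to a list of simple roots become integer lists, so that explicit
    products of reflections can be evaluated by [vm_compute]. *)
Fixpoint comb (l : seq 'I_n) (c : seq int) : 'rV[int]_n :=
  match l, c with i :: l', z :: c' => z *: alpha i + comb l' c' | _, _ => 0 end.

Fixpoint dot (r c : seq int) : int :=
  match r, c with x :: r', z :: c' => x * z + dot r' c' | _, _ => 0 end.

Definition step (T : seq (seq int)) (k : nat) (c : seq int) : seq int :=
  set_nth 0 c k (c`_k - dot (nth [::] T k) c).

(** [T] belongs to the current object; letter 0 is the only reflection changing the object, so it
    swaps the tables. *)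
Fixpoint steps (T U : seq (seq int)) (w : seq nat) (c : seq int) : seq int :=
  if w is k :: w' then
    if k == 0%N then steps U T w' (step T k c) else steps T U w' (step T k c)
  else c.

Definition is_table (a : A) (l : seq 'I_n) (i0 : 'I_n) (T : seq (seq int)) :=
  forall k, (k < size l)%N ->
    nth [::] T k = [seq C a (nth i0 l k) j | j <- l].

Lemma pairing_comb (M : 'M[int]_n) i l c :
  pairing M i (comb l c) = dot [seq M i j | j <- l] c.
Proof.
elim: l c => [|j l IH] [|z c] /=; rewrite ?pairingD ?pairingZ ?pairing_alpha ?IH 1?mulrC //.
all: by rewrite -(scale0r 0) pairingZ mul0r.
Qed.

Lemma sigma_comb a l i0 T k c : is_table a l i0 T -> (k < size l)%N ->
  size c = size l ->
  sigma C (nth i0 l k) a (comb l c) = comb l (step T k c).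
Proof.
move=> Tl kl cl; rewrite sigmaE pairing_comb -Tl // /step.
move: (dot _ _) => d; elim: l k c kl cl {Tl} => // i l IH [|k] [|z c] //= kl [cl].
  by rewrite scalerBl addrAC.
by rewrite -addrA IH.
Qed.

Lemma walk_comb a b l i0 T U w c :
  is_table a l i0 T -> is_table b l i0 U ->
  (forall k, (k < size l)%N -> rho (nth i0 l k) a = if k == 0%N then b else a) ->
  (forall k, (k < size l)%N -> rho (nth i0 l k) b = if k == 0%N then a else b) ->
  all (fun k => k < size l)%N w -> size c = size l ->
  walk rho C a [seq nth i0 l k | k <- w] (comb l c) = comb l (steps T U w c).
Proof.
elim: w a b T U c => //= k w IH a b T U c Ta Ub ra rb /andP[kl wl] cl.
rewrite (sigma_comb Ta kl cl) ra //; have cl' : size (step T k c) = size l.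
  by rewrite size_set_nth cl; apply/maxn_idPr.
by case: eqP => _; [apply: (IH b a)|apply: (IH a b)].
Qed.

(** The offset [m] is there for the induction; the application has [m = 0]. *)
Lemma comb_unit i0 (l : seq 'I_n) m k :
  comb l [seq (j == k)%:R | j <- iota m (size l)] =
  if (m <= k < m + size l)%N then alpha (nth i0 l (k - m)) else 0.
Proof.
elim: l m => [|i l IH] m /=; first by rewrite addn0; case: ifP => //; lia.
rewrite {}IH; have [->|mk] := eqVneq m k.
  by rewrite scale1r ltnn leqnn subnn addr0 ifT //; lia.
rewrite scale0r add0r; case: ifP => H; case: ifP => H' //; [|lia|lia].
by rewrite (_ : k - m = (k - m.+1).+1)%N //; lia.
Qed.

Lemma comb_nonpos (l : seq 'I_n) c : all (fun z => z <= 0) c -> nonneg (- comb l c).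
Proof.
elim: l c => [|i l IH] [|z c] //=; try by move=> *; rewrite oppr0 => j; rewrite mxE.
case/andP=> z0 /IH c0; rewrite opprD => j; rewrite mxE addr_ge0 //.
by rewrite -scaleNr mxE mulr_ge0 ?oppr_ge0 //; apply: alpha_nonneg.
Qed.

Lemma finite_steps a b l i0 T U w :
  is_table a l i0 T -> is_table b l i0 U ->
  (forall k, (k < size l)%N -> rho (nth i0 l k) a = if k == 0%N then b else a) ->
  (forall k, (k < size l)%N -> rho (nth i0 l k) b = if k == 0%N then a else b) ->
  (forall i, i \in l) -> all (fun k => k < size l)%N w ->
  all (fun k => all (fun z => z <= 0) (steps T U w [seq (j == k)%:R | j <- iota 0 (size l)]))
    (iota 0 (size l)) ->
  exists s : seq 'rV[int]_n, forall v, R a v -> v \in s.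
Proof.
move=> Ta Ub ra rb lall wl /allP neg.
apply: (finite_walk RS i0 (w := [seq nth i0 l k | k <- w])) => j.
have jl : (index j l < size l)%N by rewrite index_mem.
have := comb_unit i0 l 0 (index j l); rewrite /= subn0 nth_index // jl => <-.
rewrite (walk_comb Ta Ub) ?size_map ?size_iota //.
by apply/comb_nonpos/neg; rewrite mem_iota.
Qed.

End Finiteness.

(** * Two objects *)

Lemma positive_on_neighbours (F : realFieldType) n (M : 'M[int]_n)
    (J : {set 'I_n}) (u : 'I_n -> F) i (l : seq 'I_n) :
  gcm M -> positive_on M J u -> uniq (i :: l) -> {subset i :: l <= J} ->
  \sum_(j <- l) M i j * M j i < 4.
Proof.
move=> gM uM /= /andP[il ul] lJ; have iJ : i \in J by apply: lJ; rewrite mem_head.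
apply: le_lt_trans (positive_on_neighbour_sum gM uM iJ).
rewrite (big_uniq _ ul) /= (bigID (fun j => j \in l) (fun j => (j \in J) && _)) /=.
rewrite (eq_bigl (fun j => (j \in J) && (j != i) && (j \in l))); last first.
  move=> j; case jl: (j \in l); last by rewrite andbF.
  rewrite andbT (lJ j) ?inE ?jl ?orbT //=; apply/esym.
  by apply: contraNneq il => <-.
rewrite lerDl; apply: sumr_ge0 => j /andP[/andP[_ ji] _].
by case: gM => _ [M0 _]; apply: mulr_le0; apply: M0 => //; rewrite eq_sym.
Qed.

Lemma pairing_support n (M : 'M[int]_n) i (l : seq 'I_n) (v : 'rV[int]_n) :
  uniq l -> (forall j, j \notin l -> v 0 j = 0) ->
  pairing M i v = \sum_(j <- l) M i j * v 0 j.
Proof.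
move=> ul vl; rewrite big_uniq //= big_mkcond; apply: eq_bigr => j _.
by case: ifPn => // /vl->; rewrite mulr0.
Qed.

Lemma small_product (a b : int) : a < 0 -> b < 0 -> a * b < 4 ->
  (a = -1 /\ (b = -1 \/ b = -2 \/ b = -3)) \/ (a = -2 /\ b = -1) \/ (a = -3 /\ b = -1).
Proof.
move=> a0 b0 ab; have a4 : -4 < a by nia.
have : a = -1 \/ a = -2 \/ a = -3 by lia.
by case=> [a1|[a1|a1]]; rewrite a1 in ab *; lia.
Qed.

Section TwoObjects.
Variables (n : nat) (A : Type) (rho : 'I_n -> A -> A).
Variables (C : A -> 'M[int]_n) (R : A -> 'rV[int]_n -> Prop).
Hypothesis RS : root_system rho C R.
Variable sw : pred 'I_n.

(** [sw] abstracts the condition [i < kappa], leaving a notion symmetric in [x] and [y]. *)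
Definition two_objects (x y : A) :=
  [/\ x <> y, forall i, sw i -> rho i x = y /\ rho i y = x &
      forall i, ~~ sw i -> rho i x = x /\ rho i y = y].

Lemma two_objects_sym x y : two_objects x y -> two_objects y x.
Proof.
case=> xy Hs Hf; split; first by move/esym.
- by move=> i /Hs[].
- by move=> i /Hf[].
Qed.

Lemma cartan_swap x y i j : two_objects x y -> sw i -> C x i j = C y i j.
Proof. by case=> _ Hs _ /Hs[<- _]; rewrite (cartan_rho RS). Qed.

Lemma pairing_swap x y i v : two_objects x y -> sw i ->
  pairing (C x) i v = pairing (C y) i v.
Proof. by move=> xy si; apply: eq_bigr => j _; rewrite (cartan_swap j xy). Qed.

Lemma root_swap x y i v : two_objects x y -> sw i -> R x v ->
  R y (sigma C i x v).
Proof. by case=> _ Hs _ /Hs[<- _] Rv; apply: (root_sigma RS). Qed.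

Lemma root_fix x y i v : two_objects x y -> ~~ sw i -> R x v ->
  R x (sigma C i x v).
Proof. by case=> _ _ Hf; move/Hf => [ix _] Rv; rewrite -{1}ix; apply: (root_sigma RS). Qed.

(** The properties of s_J^x and s_J^y that drive the classification. In the last clause the same [t]
    serves every exchanged index. *)
Definition simple_sums (x y : A) (J : {set 'I_n}) (s t : 'rV[int]_n) :=
  [/\ forall j, j \in J -> 0 < s 0 j /\ 0 < t 0 j,
      forall j, j \notin J -> s 0 j = 0 /\ t 0 j = 0,
      forall i, i \in J -> ~~ sw i -> pairing (C x) i s = 2 /\ pairing (C y) i t = 2 &
      forall i, i \in J -> sw i -> t = s - (pairing (C x) i s - 2) *: alpha i].

Lemma simple_sums_exist x y J : two_objects x y -> finite_rs R ->
  exists s t, simple_sums x y J s t.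
Proof.
move=> [xy Hs Hf] fR.
have [s sP] := parabolic_sum_exists J x fR.
have [t tP] := parabolic_sum_exists J y fR.
have fixed a i w : i \in J -> rho i a = a -> parabolic_sum R J a w ->
    pairing (C a) i w = 2.
  move=> iJ ia wP; have wP' := wP; rewrite -{1}ia in wP'.
  have := parabolic_sum_sigma RS iJ wP wP'.
  move/matrixP/(_ 0 i); rewrite mxE sigma_self mxE alphaE eqxx mulr1.
  by move: (w 0 i : int) (pairing _ _ _) => z p; lia.
exists s, t; split=> [j jJ|j jJ|i iJ /Hf[ix iy]|i iJ /Hs[ix iy]].
- by split; [apply: (parabolic_sum_gt0 RS sP)|apply: (parabolic_sum_gt0 RS tP)].
- by split; [apply: (parabolic_sum_eq0 sP)|apply: (parabolic_sum_eq0 tP)].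
- by split; apply: fixed.
- rewrite (parabolic_sum_sigma RS iJ sP (w' := t)) ?ix // sigmaE.
  by rewrite scalerBl opprB addrA addrAC.
Qed.

Lemma simple_sums_pairing x y J s t i : two_objects x y ->
  simple_sums x y J s t -> i \in J -> sw i ->
  pairing (C y) i t = 4 - pairing (C x) i s.
Proof.
move=> xy [_ _ _ Hs] iJ si; have tE := Hs i iJ si.
rewrite -(pairing_swap t xy si) tE pairingD pairingN pairingZ pairing_alpha.
by have [-> _] := rs_gcm RS x; move: (pairing _ _ _) => p; lia.
Qed.

Lemma simple_sums_sym x y J s t : two_objects x y ->
  simple_sums x y J s t -> simple_sums y x J t s.
Proof.
move=> xy st; have pair := simple_sums_pairing xy st.
case: st => H1 H2 H3 H4; split=> [j /H1[]|j /H2[]|i iJ /(H3 i iJ)[]|i iJ si] //.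
rewrite pair //; have := H4 i iJ si.
move: (pairing _ _ _) => p ->.
by apply/matrixP=> k l; rewrite !mxE; ring.
Qed.

Lemma simple_sums_positive (F : realFieldType) x y J s t : simple_sums x y J s t ->
  (forall i, i \in J -> sw i -> 2 <= pairing (C x) i s) ->
  positive_on (C x) J (fun i => (s 0 i)%:~R : F).
Proof.
move=> [H1 H2 H3 _] H i iJ; split; first by rewrite ltr0z; case: (H1 i iJ).
have -> : \sum_(j in J) (C x i j)%:~R * (s 0 j)%:~R = (pairing (C x) i s)%:~R :> F.
  rewrite rmorph_sum big_mkcond /=; apply: eq_bigr => j _.
  by case: ifPn => [_|/H2[-> _]]; rewrite ?rmorphM // mulr0.
rewrite ltr0z; have [/(H i iJ)|/(H3 i iJ)[-> _]//] := boolP (sw i).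
exact: lt_le_trans.
Qed.

Lemma simple_sums_dichotomy x y J s t : two_objects x y -> simple_sums x y J s t ->
  (forall i, i \in J -> sw i -> 2 <= pairing (C x) i s) \/
  (forall i, i \in J -> sw i -> 2 <= pairing (C y) i t).
Proof.
move=> xy st.
have [?|H] := classic (forall i, i \in J -> sw i -> 2 <= pairing (C x) i s).
  by left.
right=> i iJ si; rewrite (simple_sums_pairing xy st) //.
suff : pairing (C x) i s <= 2 by move: (pairing _ _ _) => p; lia.
rewrite leNgt; apply/negP=> ip; apply: H => l lJ sl; rewrite leNgt; apply/negP=> lp.
have [_ _ _ H4] := st; have := H4 i iJ si; rewrite (H4 l lJ sl).
have il : l != i by apply: contraTneq lp => ->; rewrite -leNgt ltW.
(* Computed through [i], coordinate [l] of [t] equals that of [s]; computed through [l], it is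
   larger. *)
move/matrixP/(_ 0 l); rewrite !mxE !eqxx (negPf il) /=.
by move: (s 0 l : int) ip lp => z; move: (pairing _ _ _) (pairing _ _ _) => p q; lia.
Qed.

(** * One exchanged and one fixed index *)

Section RankTwo.
Variables (x y : A) (i j : 'I_n).
Hypothesis xy : two_objects x y.
Hypotheses (si : sw i) (fj : ~~ sw j).

Let vec (p q : int) : 'rV[int]_n := p *: alpha i + q *: alpha j.
Let ij : i != j. Proof. by apply: contraNneq fj => <-. Qed.

Lemma rank2_pairing a k p q : pairing (C a) k (vec p q) = p * C a k i + q * C a k j.
Proof. by rewrite pairingD !pairingZ !pairing_alpha. Qed.

Lemma rank2_reflect_i a p q : sigma C i a (vec p q) = vec (- p - q * C a i j) q.
Proof.
rewrite sigmaE rank2_pairing; have [-> _] := rs_gcm RS a.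
by apply/matrixP=> k l; rewrite !mxE; ring.
Qed.

Lemma rank2_reflect_j a p q : sigma C j a (vec p q) = vec p (- q - p * C a j i).
Proof.
rewrite sigmaE rank2_pairing; have [-> _] := rs_gcm RS a.
by apply/matrixP=> k l; rewrite !mxE; ring.
Qed.

Lemma rank2_sign a p q : R a (vec p q) -> (0 <= p /\ 0 <= q) \/ (p <= 0 /\ q <= 0).
Proof.
have vi : vec p q 0 i = p by rewrite !mxE !eqxx (negPf ij) mulr0 mulr1 addr0.
have vj : vec p q 0 j = q.
  by rewrite !mxE !eqxx eq_sym (negPf ij) mulr0 mulr1 add0r.
move=> /(root_sign RS)[H|H]; [left|right].
  have Hi : 0 <= vec p q 0 i := H i; have Hj : 0 <= vec p q 0 j := H j.
  by rewrite vi vj in Hi Hj.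
have Hi : 0 <= - vec p q 0 i by have := H i; rewrite mxE.
have Hj : 0 <= - vec p q 0 j by have := H j; rewrite mxE.
by rewrite vi vj !oppr_ge0 in Hi Hj.
Qed.

Lemma rank2_i_x p q : R x (vec p q) -> R y (vec (- p - q * C x i j) q).
Proof. by move=> Rv; rewrite -rank2_reflect_i; apply: root_swap xy si Rv. Qed.

Lemma rank2_i_y p q : R y (vec p q) -> R x (vec (- p - q * C x i j) q).
Proof.
move=> Rv; rewrite (cartan_swap j xy si) -rank2_reflect_i.
exact: root_swap (two_objects_sym xy) si Rv.
Qed.

Lemma rank2_j_x p q : R x (vec p q) -> R x (vec p (- q - p * C x j i)).
Proof. by move=> Rv; rewrite -rank2_reflect_j; apply: root_fix xy fj Rv. Qed.

Lemma rank2_j_y p q : R y (vec p q) -> R y (vec p (- q - p * C y j i)).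
Proof.
by move=> Rv; rewrite -rank2_reflect_j; apply: root_fix (two_objects_sym xy) fj Rv.
Qed.

Lemma rank2_vec_i a : R a (vec 1 0).
Proof. by rewrite /vec scale1r scale0r addr0; apply: root_alpha RS a i. Qed.

(* The roots spanned by alpha_i and alpha_j are then of type A_2, so (R4) yields
   (rho_i rho_j)^3 x = x, but rho_i exchanges x and y and rho_j fixes both. *)
Lemma rank2_not_A2 : C x i j = -1 -> C x j i = -1 -> C y j i = -1 -> False.
Proof.
move=> cij cxji cyji.
have [xny Hs Hf] := xy; have [ixy iyx] := Hs i si; have [jx jy] := Hf j fj.
have scale_j a q : R a (vec 0 q) -> 0 <= q -> q = 1.
  by rewrite /vec scale0r add0r => /(root_scale_alpha RS)[->|->].
have [_ [_ [_ [_ R4]]]] := RS.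
suff /(R4 x i j 3%N ij) : has_card (rank2_part (R x) i j) 3%N.
  by rewrite /= jx ixy jy iyx jx ixy => yx; apply: xny.
exists [:: vec 1 0; vec 0 1; vec 1 1]; split; last split=> //.
  have vE p q p' q' : vec p q = vec p' q' -> p = p'.
    move/matrixP/(_ 0 i); rewrite !mxE !eqxx (negPf ij) !mulr0 !mulr1 !addr0.
    exact.
  have vE' p q p' q' : vec p q = vec p' q' -> q = q'.
    move/matrixP/(_ 0 j); rewrite !mxE !eqxx eq_sym (negPf ij) !mulr0 !mulr1 !add0r.
    exact.
  rewrite /= !inE; apply/andP; split.
    by apply/norP; split; apply/eqP=> v_eq; [have := vE _ _ _ _ v_eq|have := vE' _ _ _ _ v_eq].
  by rewrite andbT; apply/eqP=> /vE.
move=> v; split.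
  rewrite !inE => /or3P[]/eqP->; split.
  - exact: rank2_vec_i.
  - by exists 1%N, 0%N.
  - by rewrite /vec scale0r add0r scale1r; apply: root_alpha RS x j.
  - by exists 0%N, 1%N.
  - by have := rank2_j_x (rank2_vec_i x); rewrite cxji; congr (R x (vec _ _)).
  - by exists 1%N, 1%N.
case=> Rv [p [q vE]]; rewrite {}vE -/(vec p q) in Rv *.
(* The images are (q - p, q) and then (q - p, - p); sign-coherence leaves p = 0, q = 0 or p = q. *)
have R1 := rank2_i_x Rv; have R2 := rank2_j_y R1.
rewrite cij cyji in R1 R2.
have [pq|pq|pq] := ltngtP p q.
- have p0 : p = 0%N by case: (rank2_sign R2); lia.
  rewrite p0 in Rv *; have := scale_j _ _ Rv; rewrite !inE => -> //.
  by rewrite eqxx orbT.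
- have q0 : q = 0%N by case: (rank2_sign R1); lia.
  rewrite q0 in Rv *; have := Rv; rewrite /vec scale0r addr0.
  by case/(root_scale_alpha RS) => // ->; rewrite !inE scale0r addr0 eqxx.
- have q1 : q%:Z = 1.
    have : R y (vec 0 q) by move: R1; congr (R y (vec _ _)); lia.
    by move/scale_j; apply.
  by rewrite pq q1 !inE eqxx !orbT.
Qed.

(* Short words in sigma_i, sigma_j applied to alpha_i give roots whose two coordinates
   must agree in sign, which decides C y j i; only if C x i j * C x j i = 3 are the
   equations for s and t needed. *)
Lemma rank2_half s t : simple_sums x y [set i; j] s t -> 2 <= pairing (C x) i s ->
  (C x j i = C y j i /\ C x i j * C x j i <> 1) \/
  (C x i j = -1 /\ C x j i = -3 /\ (C y j i = -4 \/ C y j i = -5)).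
Proof.
move=> st si2.
have uij : uniq [:: i; j] by rewrite /= inE ij.
have iJ : i \in [set i; j] by rewrite !inE eqxx.
have jJ : j \in [set i; j] by rewrite !inE eqxx orbT.
have pos : positive_on (C x) [set i; j] (fun k => (s 0 k)%:~R : rat).
  apply: simple_sums_positive st _ => k; rewrite !inE => /orP[/eqP-> //|/eqP->].
  by rewrite (negPf fj).
have ab3 : C x i j * C x j i < 4.
  have := positive_on_neighbours (rs_gcm RS x) pos uij.
  rewrite big_seq1; apply=> k; rewrite !inE; exact.
have [H1 H2 H3 H4] := st.
have supp (w : 'rV[int]_n) : (forall k, k \notin [set i; j] -> w 0 k = 0) ->
    forall M k,
    pairing M k w = M k i * w 0 i + M k j * w 0 j.
  move=> w0 M k; rewrite (@pairing_support n M k [:: i; j] w) //.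
    by rewrite big_cons big_seq1.
  by move=> m mij; apply: w0; rewrite !inE in mij *.
have tE : t 0 i = s 0 i - (pairing (C x) i s - 2) /\ t 0 j = s 0 j.
  by rewrite (H4 i iJ si) !mxE !eqxx eq_sym (negPf ij) /=; split; ring.
have [s0 t0] := H1 i iJ; have [s0' t0'] := H1 j jJ.
have [P1 P2] := H3 j jJ fj.
have E1 : pairing (C x) i s = 2 * s 0 i + C x i j * s 0 j.
  by rewrite supp => [|k /H2[]//]; have [-> _] := rs_gcm RS x.
have E2 : C x j i * s 0 i + 2 * s 0 j = 2.
  by rewrite -[RHS]P1 supp => [|k /H2[]//]; have [-> _] := rs_gcm RS x.
have E3 : C y j i * t 0 i + 2 * t 0 j = 2.
  by rewrite -[RHS]P2 supp => [|k /H2[]//]; have [-> _] := rs_gcm RS y.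
case: tE => tE1 tE2; rewrite tE1 tE2 E1 in E3 t0; rewrite E1 in si2.
have [_ [gx0 gx]] := rs_gcm RS x; have [_ [gy0 gy]] := rs_gcm RS y.
have A0 := gx0 i j ij; have B0 : C x j i <= 0 by apply: gx0; rewrite eq_sym.
have B0' : C y j i <= 0 by apply: gy0; rewrite eq_sym.
have Cij : C y i j = C x i j by rewrite (cartan_swap j xy si).
have Z1 := gx i j; have Z2 := gx j i; have Z3 := gy i j; have Z4 := gy j i.
rewrite Cij in Z3 Z4.
(* With a = C x i j, b = C x j i and b' = C y j i, [W1] has coordinates a b' - 1 and b' - (a b' - 1)
   b; [V1] is the same with b and b' interchanged. [W2] and [V2] add one reflection at i. *)
have W1 := rank2_j_x (rank2_i_y (rank2_j_y (rank2_vec_i y))).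
have W2 := rank2_i_x W1.
have V1 := rank2_j_y (rank2_i_x (rank2_j_x (rank2_vec_i x))).
have V2 := rank2_i_y V1.
have notA2 := rank2_not_A2.
move: (s 0 i : int) (s 0 j : int) s0 s0' t0 E2 E3 si2
  {E1 H1 H2 H3 H4 tE1 tE2 supp t0' P1 P2} => p q.
move: W1 W2 V1 V2 => /rank2_sign W1 /rank2_sign W2 /rank2_sign V1 /rank2_sign V2.
move: (C x i j) (C x j i) (C y j i) notA2 ab3 A0 B0 B0' Z1 Z2 Z3 Z4 W1 W2 V1 V2.
move=> a b b' notA2 ab3 a0 b0 b0' Z1 Z2 Z3 Z4 W1 W2 V1 V2 p0 q0 pd E2 E3 si2.
clear -notA2 ab3 a0 b0 b0' Z1 Z2 Z3 Z4 W1 W2 V1 V2 p0 q0 pd E2 E3 si2.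
have [a00|an0] := eqVneq a 0.
  by left; rewrite a00 in Z1 Z3 *; rewrite (Z1 erefl) (Z3 erefl).
have bn0 : b != 0 by apply: contraNneq an0 => /Z2->.
have bn0' : b' != 0 by apply: contraNneq an0 => /Z4->.
have an : a < 0 by rewrite lt_neqAle an0.
have bn : b < 0 by rewrite lt_neqAle bn0.
have [[a1 [b1|[b1|b1]]]|[[a1 b1]|[a1 b1]]] := small_product an bn ab3.
- have b1' : b' = -1 by clear -b0' bn0' W1 a1 b1; rewrite a1 b1 in W1; lia.
  by case: notA2.
- have b1' : b' = -2.
    by clear -b0' bn0' W2 V1 a1 b1; rewrite a1 b1 in W2 V1; lia.
  by left; rewrite a1 b1 b1'.
- have b1' : b' = -3 \/ b' = -4 \/ b' = -5.
    rewrite a1 b1 in V1 V2 E2 E3 si2 pd.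
    (* Here p = 2m and q = 3m + 1, so [E3] reads b' (m + 3) = - 6m and b' > -6. The signs of [V1]
       and [V2] then exclude -1 and -2. *)
    have le5 : -5 <= b' by clear -b0' bn0' E2 E3 si2 pd p0 q0; nia.
    by clear -b0' le5 V1 V2 bn0'; lia.
  by case: b1' => [->|[->|->]]; rewrite a1 b1; [left|right; do 2!split=> //; left|
    right; do 2!split=> //; right].
- have b1' : b' = -1 by clear -b0' bn0' W2 a1 b1; rewrite a1 b1 in W2; lia.
  by left; rewrite a1 b1 b1'.
- have b1' : b' = -1.
    (* Now p = 2q - 2, so [E3] reads b' (q + 4) = 2 - 2q and b' > -2. *)
    by rewrite a1 b1 in E2 E3 si2 pd; clear -b0' bn0' E2 E3 si2 pd p0 q0; nia.
  by left; rewrite a1 b1 b1'.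
Qed.

End RankTwo.

End TwoObjects.

Lemma gcm_product_ge1 n (M : 'M[int]_n) i j :
  gcm M -> i != j -> M i j != 0 -> 1 <= M i j * M j i.
Proof.
move=> [_ [M0 M00]] ij Mij; have Mji : M j i != 0.
  by apply: contraNneq Mij => /M00->.
have := M0 i j ij; have := M0 j i; rewrite eq_sym => /(_ ij).
by move: (M i j) (M j i) Mij Mji => a b; clear; nia.
Qed.

Lemma sum_set_seq (V : nmodType) (T : finType) (l : seq T) (f : T -> V) :
  uniq l -> \sum_(j in [set k | k \in l]) f j = \sum_(j <- l) f j.
Proof. by move=> ul; rewrite big_uniq //; apply: eq_bigl => j; rewrite inE. Qed.

(* If both products are 2, this is an affine diagram of type C_3^(1), D_4^(2) or A_6^(2). *)
Lemma positive_on_double_chain (F : realFieldType) n (M : 'M[int]_n)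
    (u : 'I_n -> F) l p q r :
  gcm M -> positive_on M [set: 'I_n] u -> uniq [:: l; p; q; r] ->
  2 <= M l p * M p l -> M p q = -1 -> M q p = -1 -> 2 <= M q r * M r q -> False.
Proof.
move=> gM uM uni lp pq qp qr.
have sub : [set k | k \in [:: l; p; q; r]] \subset [set: 'I_n] by apply: subsetT.
have row i : i \in [:: l; p; q; r] ->
    0 < u i /\ 0 < \sum_(j <- [:: l; p; q; r]) (M i j)%:~R * u j.
  move=> il; have [] := positive_on_subset gM sub uM (i := i).
    by rewrite inE.
  by rewrite sum_set_seq.
have le0 i j : i != j -> (M i j)%:~R <= 0 :> F.
  by move=> ij; apply: (gcm_le0 F gM); rewrite eq_sym.
have Mii i : (M i i)%:~R = 2 :> F by case: gM => ->.
have ge2 i j : 2 <= M i j * M j i -> 2 <= (M i j)%:~R * (M j i)%:~R :> F.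
  by rewrite -rmorphM /= -[2 in X in _ -> X]/(2%:~R) ler_int.
(* The row of an outer vertex, multiplied by b. Inserted into the rows of p and q, it yields u q < u
   p and u p < u q. *)
have edge a b z w e : 0 <= z -> a <= 0 -> b <= 0 -> 2 <= a * b ->
    0 < 2 * w + a * z + e -> e <= 0 -> z <= - b * w :> F.
  move=> z0 a0 b0 ab h e0.
  have : b * (2 * w + a * z) <= 0 by rewrite mulr_le0_ge0 //; lra.
  have : 2 * z <= a * b * z by rewrite ler_wpM2r.
  by lra.
have neg i j : i != j -> 0 <= u j -> (M i j)%:~R * u j <= 0.
  by move=> ij uj; rewrite mulr_le0_ge0 ?le0.
have := row l; have := row p; have := row q; have := row r.
rewrite !inE !eqxx !orbT => /(_ isT)[ur rr] /(_ isT)[uq rq] /(_ isT)[up rp] /(_ isT)[ul rl].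
move: uni; rewrite /= !inE !negb_or -!andbA => /and4P[l_p l_q l_r /and3P[p_q p_r /andP[q_r _]]].
have qp' : (M q p)%:~R = -1 :> F by rewrite qp.
have pq' : (M p q)%:~R = -1 :> F by rewrite pq.
rewrite !big_cons !big_nil !Mii ?qp' ?pq' in rr rq rp rl.
have p_l : p != l by rewrite eq_sym.
have r_q : r != q by rewrite eq_sym.
have n1 := neg l q l_q (ltW uq); have n2 := neg l r l_r (ltW ur).
have n3 := neg p r p_r (ltW ur).
have n4 : (M q l)%:~R * u l <= 0 by rewrite neg 1?eq_sym ?ltW.
have n5 : (M r l)%:~R * u l <= 0 by rewrite neg 1?eq_sym ?ltW.
have n6 : (M r p)%:~R * u p <= 0 by rewrite neg 1?eq_sym ?ltW.
have H1 : u p <= - (M p l)%:~R * u l.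
  apply: (edge _ _ _ _ ((M l q)%:~R * u q + (M l r)%:~R * u r) (ltW up)
    (le0 _ _ l_p) (le0 _ _ p_l) (ge2 _ _ lp)); lra.
have H2 : u q <= - (M q r)%:~R * u r.
  have rq2 : 2 <= M r q * M q r by rewrite mulrC.
  apply: (edge _ _ _ _ ((M r l)%:~R * u l + (M r p)%:~R * u p) (ltW uq)
    (le0 _ _ r_q) (le0 _ _ q_r) (ge2 _ _ rq2)); lra.
by clear -rp rq H1 H2 n3 n4; lra.
Qed.

(** * Edges and zero entries compared between the two objects *)

Section Classification.
Variables (n : nat) (A : Type) (rho : 'I_n -> A -> A).
Variables (C : A -> 'M[int]_n) (R : A -> 'rV[int]_n -> Prop).
Hypothesis RS : root_system rho C R.
Hypothesis fR : finite_rs R.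
Variable sw : pred 'I_n.

Lemma root_pairing_le a i v : R a v -> nonneg v -> v <> alpha i ->
  pairing (C a) i v <= v 0 i.
Proof.
move=> Rv v0 vi; have := root_sigma_nonneg RS Rv v0 vi i.
by rewrite sigma_self subr_ge0.
Qed.

Lemma rank2_cases x y i j : two_objects rho sw x y -> sw i -> ~~ sw j ->
  (C x j i = C y j i /\ C x i j * C x j i <> 1) \/
  (C x i j = -1 /\ ((C x j i = -3 /\ (C y j i = -4 \/ C y j i = -5)) \/
                    (C y j i = -3 /\ (C x j i = -4 \/ C x j i = -5)))).
Proof.
move=> xy si fj; have yx := two_objects_sym xy.
have [s [t st]] := simple_sums_exist RS [set i; j] xy fR.
have iJ : i \in [set i; j] by rewrite !inE eqxx.
have [/(_ i iJ si) H|/(_ i iJ si) H] := simple_sums_dichotomy RS xy st.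
  by have [H'|[? []]] := rank2_half RS xy si fj st H; [left|right; split=> //; left].
have ts := simple_sums_sym RS xy st.
have := rank2_half RS yx si fj ts H.
rewrite -(cartan_swap RS j xy si) => -[[H1 H2]|[? []]].
  by left; rewrite -H1.
by right; split=> //; right.
Qed.

Lemma rank2_product_ge2 x y i j : two_objects rho sw x y -> sw i -> ~~ sw j ->
  C x i j != 0 -> 2 <= C x i j * C x j i.
Proof.
move=> xy si fj Cij; have ij : i != j by apply: contraNneq fj => <-.
have := gcm_product_ge1 (rs_gcm RS x) ij Cij.
case: (rank2_cases xy si fj) => [[_]|[-> [[-> _]|[_ [->|->]]]]] //.
by move: (C x i j * C x j i) => z; lia.
Qed.

Lemma rank2_zero x y i j : two_objects rho sw x y -> sw i -> ~~ sw j ->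
  C x j i = 0 -> C y j i = 0.
Proof.
move=> xy si fj; have [[-> _]//|] := rank2_cases xy si fj.
by case=> _ [[-> _]|[_ [->|->]]].
Qed.

(** The degree bound at i holds at whichever object the dichotomy for {i, j, k} selects. *)
Lemma positive_triple x y i j k : two_objects rho sw x y -> sw i -> ~~ sw j -> ~~ sw k ->
  j != k -> C x i j * C x j i + C x i k * C x k i < 4 \/
            C y i j * C y j i + C y i k * C y k i < 4.
Proof.
move=> xy si fj fk jk; pose J := [set m | m \in [:: i; j; k]].
have ij : i != j by apply: contraNneq fj => <-.
have ik : i != k by apply: contraNneq fk => <-.
have uni : uniq [:: i; j; k] by rewrite /= !inE negb_or ij ik jk.
have sub : {subset [:: i; j; k] <= J} by move=> m ml; rewrite /J in_set.
have [s [t st]] := simple_sums_exist RS J xy fR.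
have [H|H] := simple_sums_dichotomy RS xy st; [left|right].
  have pos := simple_sums_positive rat st H.
  have := positive_on_neighbours (rs_gcm RS x) pos uni sub.
  by rewrite big_cons big_seq1.
have pos := simple_sums_positive rat (simple_sums_sym RS xy st) H.
have := positive_on_neighbours (rs_gcm RS y) pos uni sub.
by rewrite big_cons big_seq1.
Qed.

(* If C^x j k = 0 <> C^y j k, sigma_i carries a root supported on j, k at y to a root
   at x whose support must have no isolated vertex, so i is joined to both j and k by
   multiple edges. *)
Lemma fixed_zero x y i j k : two_objects rho sw x y -> sw i -> ~~ sw j -> ~~ sw k ->
  C x j k = 0 -> C y j k = 0.
Proof.
move=> xy si fj fk Cjk; have yx := two_objects_sym xy.
have [jk|jk] := eqVneq j k.
  by move: Cjk; rewrite jk; case: (rs_gcm RS x) => ->.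
have ij : i != j by apply: contraNneq fj => <-.
have ik : i != k by apply: contraNneq fk => <-.
have [Cxii [_ Cx0]] := rs_gcm RS x; have [_ [Cy_le0 Cy0]] := rs_gcm RS y.
apply/eqP/negPn/negP=> Cyjk.
have Cykj : C y k j < 0.
  rewrite lt_neqAle Cy_le0 1?eq_sym // andbT.
  by apply: contraNneq Cyjk => kj0; rewrite (Cy0 _ _ (esym kj0)).
set e := - C y k j; have e0 : 0 < e by rewrite oppr_gt0.
have Rv : R y (alpha j + e *: alpha k) by rewrite scaleNr; apply: (root_string_end RS).
have Rv' := root_swap RS yx si Rv.
move: Rv'; rewrite sigmaE; set f := pairing _ _ _; set w := _ - _ => Rw.
have wj : w 0 j = 1.
  by rewrite !mxE !eqxx (negPf jk) eq_sym (negPf ij) /=; lia.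
have wk : w 0 k = e.
  by rewrite !mxE !eqxx eq_sym (negPf jk) [k == i]eq_sym (negPf ik) /=; lia.
have w0 : nonneg w.
  have [//|/(_ j)] := root_sign RS Rw.
  by rewrite mxE wj.
have wp m : pairing (C x) m w = C x m j + e * C x m k - f * C x m i.
  by rewrite pairingD pairingN pairingD !pairingZ !pairing_alpha.
(* If it vanished, row j of C^x at [w] would be 2, exceeding coordinate 1 of [w] at j, against
   [root_pairing_le]. For k the same comparison is between 2e and e. *)
have Cxij : C x i j != 0.
  have wj' : w <> alpha j.
    by move=> wE; move: e0; rewrite -wk wE alphaE eq_sym (negPf jk).
  have := root_pairing_le Rw w0 wj'; rewrite wp wj Cxii Cjk => H.
  by apply: contraTneq H => /Cx0->; rewrite !mulr0.
have Cxik : C x i k != 0.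
  have wk' : w <> alpha k.
    by move=> wE; move: wj; rewrite wE alphaE (negPf jk).
  have := root_pairing_le Rw w0 wk'; rewrite wp wk Cxii (Cx0 _ _ Cjk) => H.
  by apply: contraTneq H => /Cx0->; rewrite mulr0 subr0 add0r -ltNge; lia.
have Cyij : C y i j != 0 by rewrite -(cartan_swap RS j xy si).
have Cyik : C y i k != 0 by rewrite -(cartan_swap RS k xy si).
have := rank2_product_ge2 xy si fj Cxij; have := rank2_product_ge2 xy si fk Cxik.
have := rank2_product_ge2 yx si fj Cyij; have := rank2_product_ge2 yx si fk Cyik.
case: (positive_triple xy si fj fk jk).
all: move: (_ * _) (_ * _) (_ * _) (_ * _) => a b c d; lia.
Qed.

Lemma cartan_zero x y i0 j k : two_objects rho sw x y -> sw i0 ->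
  C x j k = 0 -> C y j k = 0.
Proof.
move=> xy s0; have [sj|fj] := boolP (sw j); first by rewrite (cartan_swap RS k xy sj).
have [sk|fk] := boolP (sw k); first exact: rank2_zero xy sk fj.
exact: fixed_zero xy s0 fj fk.
Qed.

(** The reflection at l fixes [alpha p] and [alpha q], so it carries the end of the string of
    [alpha p] through [alpha q] unchanged to the other object. *)
Lemma fixed_nonadjacent x y l p q : two_objects rho sw x y -> sw l -> p != q ->
  l != p -> l != q -> C x l p = 0 -> C x l q = 0 -> C x p q = C y p q.
Proof.
move=> xy sl pq lp lq lp0 lq0.
have half a b : two_objects rho sw a b -> C a l p = 0 -> C a l q = 0 ->
    - C a p q <= - C b p q.
  move=> ab ap aq; have := root_swap RS ab sl (root_string_end RS a p q).
  rewrite sigmaE pairingD pairingN pairingZ !pairing_alpha ap aq mulr0 subr0.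
  by rewrite scale0r subr0 -scaleNr; apply: (root_string_le RS).
have ylp : C y l p = 0 by rewrite -(cartan_swap RS p xy sl).
have ylq : C y l q = 0 by rewrite -(cartan_swap RS q xy sl).
apply/eqP; rewrite eq_le; apply/andP; split; rewrite -lerN2; apply: half => //.
exact: two_objects_sym.
Qed.

End Classification.

(** * From block-diagonal matrices to reducible root systems *)

Section Reducibility.
Variables (n : nat) (A : Type) (rho : 'I_n -> A -> A).
Variables (C : A -> 'M[int]_n) (R : A -> 'rV[int]_n -> Prop).
Hypothesis RS : root_system rho C R.
Hypothesis fR : finite_rs R.
Variables (sw : pred 'I_n) (I1 : {set 'I_n}).

Definition block_diagonal (M : 'M[int]_n) :=
  forall i j, (i \in I1) != (j \in I1) -> M i j = 0.

Definition mixed (v : 'rV[int]_n) := ~ in_span I1 v /\ ~ in_span (~: I1) v.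

Lemma sigma_block a i (J : {set 'I_n}) v : block_diagonal (C a) ->
  J = I1 \/ J = ~: I1 -> in_span J v -> in_span J (sigma C i a v).
Proof.
move=> bd JE vJ; have [iJ|iJ] := boolP (i \in J); first exact: sigma_in_span.
suff p0 : pairing (C a) i v = 0 by rewrite sigmaE p0 scale0r subr0.
apply: big1 => j _; have [jJ|/vJ->] := boolP (j \in J); last by rewrite mulr0.
rewrite bd ?mul0r //; move: iJ jJ.
by case: JE => ->; rewrite ?inE => iJ jJ; rewrite ?(negPf iJ) ?jJ ?(negPf jJ) //;
  move: iJ; rewrite negbK => ->.
Qed.

Lemma sigma_mixed a i v : block_diagonal (C a) -> block_diagonal (C (rho i a)) ->
  mixed v -> mixed (sigma C i a v).
Proof.
move=> bd bd' [v1 v2]; split=> sv; [apply: v1|apply: v2];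
  rewrite -(sigmaK RS i a v); apply: sigma_block => //; [left|right]; by [].
Qed.

Lemma mixed_neq_alpha v i : mixed v -> v <> alpha i.
Proof.
move=> [v1 v2] vi; have [iI|iI] := boolP (i \in I1).
  by apply: v1; rewrite vi; apply: alpha_in_span.
by apply: v2; rewrite vi; apply: alpha_in_span; rewrite inE.
Qed.

(* Let S be the sum of the mixed positive roots at x. The row i of C^x S is zero unless
   rho_i exchanges x and y, and then the sum at y is S minus (C^x S)_i alpha_i; hence
   C^x S has positive entries in at most one of the two blocks, and S vanishes on the
   other. *)
Lemma no_mixed_root (F : realFieldType) (u : 'I_n -> F) x y v :
  two_objects rho sw x y ->
  block_diagonal (C x) -> block_diagonal (C y) ->
  positive_on (C x) [set: 'I_n] u -> R x v -> nonneg v -> mixed v -> False.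
Proof.
move=> xy bdx bdy ux Rv v0 vm.
have [s sP] := positive_roots_exist mixed x fR.
have [t tP] := positive_roots_exist mixed y fR.
have [xny Hs Hf] := xy.
have bd a i : a = x \/ a = y -> block_diagonal (C a) /\ block_diagonal (C (rho i a)).
  by case=> ->; split=> //; have [/Hs[ix iy]|/Hf[ix iy]] := boolP (sw i); rewrite ?ix ?iy.
have step a i s' t' : a = x \/ a = y -> positive_roots R mixed a s' ->
    positive_roots R mixed (rho i a) t' ->
    \sum_(w <- t') w = sigma C i a (\sum_(w <- s') w).
  move=> axy s'P t'P; have [bda bda'] := bd a i axy.
  apply: (positive_roots_sigma RS s'P t'P) => w _ _ wm; split;
    try exact: mixed_neq_alpha; apply: sigma_mixed => //.
  by rewrite (rhoK RS).
set S := \sum_(w <- s) w in step *.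
have Sfix i : ~~ sw i -> pairing (C x) i S = 0.
  move=> fi; have [ix _] := Hf i fi.
  have sP' : positive_roots R mixed (rho i x) s by rewrite ix.
  have /matrixP/(_ 0 i) := step x i s s (or_introl erefl) sP sP'.
  rewrite sigma_self -/S; move: (S 0 i : int) (pairing _ _ _) => z p; lia.
have Sswap i : sw i -> \sum_(w <- t) w = S - pairing (C x) i S *: alpha i.
  move=> si; have [ix _] := Hs i si.
  have tP' : positive_roots R mixed (rho i x) t by rewrite ix.
  by rewrite (step x i s t (or_introl erefl) sP tP').
have [us sE] := sP.
have vs : v \in s by apply/sE.
have Sv k : v 0 k <= S 0 k.
  rewrite /S summxE (big_rem v) //= lerDl big_seq; apply: sumr_ge0 => w /mem_rem ws.
  by have [_ [w0 _]] := (sE w).1 ws; apply: w0.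
(* If no row of J were positive at S, the minimum principle for - S on J would give S <= 0 there; as
   0 <= v <= S, v would vanish on J and not be mixed. *)
have block (J : {set 'I_n}) : J = I1 \/ J = ~: I1 ->
    exists2 l, l \in J & 0 < pairing (C x) l S.
  move=> JE; apply: NNPP => noJ.
  have Jx i j : i \in J -> j \notin J -> C x i j = 0.
    move=> iJ jJ; apply: bdx; move: iJ jJ.
    by case: JE => ->; rewrite ?inE ?negbK => iJ jJ; rewrite ?iJ ?(negPf iJ) ?(negPf jJ) ?jJ.
  have uJ := positive_on_subset (rs_gcm RS x) (subsetT J) ux.
  have S0 i : i \in J -> S 0 i <= 0.
    move=> iJ; rewrite -oppr_ge0 -(ler_int F).
    apply: (positive_on_nonneg (rs_gcm RS x) uJ (v := fun i => (- S 0 i)%:~R)) => // k kJ.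
    have -> : \sum_(j in J) (C x k j)%:~R * (- S 0 j)%:~R = (- pairing (C x) k S)%:~R :> F.
      rewrite big_mkcond -sumrN rmorph_sum; apply: eq_bigr => j _ /=.
      by case: ifPn => [_|/(Jx k j kJ)->]; rewrite -?rmorphM ?mul0r ?oppr0 // mulrN.
    by rewrite ler0z oppr_ge0 leNgt; apply/negP=> kS; apply: noJ; exists k.
  have vJ i : i \in J -> v 0 i = 0.
    move=> iJ; have := Sv i; have := S0 i iJ; have := v0 i.
    by move: (v 0 i : int) (S 0 i : int) => a b; lia.
  case: vm => v1 v2; case: JE => JE; [apply: v2|apply: v1] => i iJ; apply: vJ.
    by rewrite JE; move: iJ; rewrite inE negbK.
  by rewrite JE inE.
have [l1 l1I p1] := block I1 (or_introl erefl).
have [l2 l2I p2] := block (~: I1) (or_intror erefl).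
have sw_of l : 0 < pairing (C x) l S -> sw l.
  by apply: contraTT => /Sfix->.
have := Sswap l1 (sw_of _ p1); rewrite (Sswap l2 (sw_of _ p2)).
have l12 : l1 != l2 by apply: contraTneq l2I => <-; rewrite inE l1I.
move/matrixP/(_ 0 l1); rewrite !mxE !eqxx (negPf l12) /=.
by move: p1; move: (pairing (C x) l1 S) (pairing (C x) l2 S) => p q; move: (S 0 l1 : int) => z; lia.
Qed.

(** [no_mixed_root] applies at the object selected by the dichotomy; the reflection at [i0] carries
    mixed positive roots there from the other one. *)
Lemma block_diagonal_reducible x y i0 : two_objects rho sw x y ->
  (forall a, a = x \/ a = y) -> sw i0 ->
  I1 != set0 -> ~: I1 != set0 -> block_diagonal (C x) -> block_diagonal (C y) ->
  reducible R.
Proof.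
move=> xy allA s0 I1n I1cn bdx bdy.
have yx := two_objects_sym xy.
have [s [t st]] := simple_sums_exist RS [set: 'I_n] xy fR.
have nomix : exists a, forall v, R a v -> nonneg v -> ~ mixed v.
  have [H|H] := simple_sums_dichotomy RS xy st.
    have ux := simple_sums_positive rat st H.
    by exists x => v Rv v0; apply: no_mixed_root xy bdx bdy ux Rv v0.
  have uy := simple_sums_positive rat (simple_sums_sym RS xy st) H.
  by exists y => v Rv v0; apply: no_mixed_root yx bdy bdx uy Rv v0.
have bd a : block_diagonal (C a) by case: (allA a) => ->.
have nomix' a v : R a v -> nonneg v -> ~ mixed v.
  case: nomix => b nb Rv v0 vm.
  have [ab|ab] : a = b \/ rho i0 a = b.
    have [_ /(_ i0 s0)[ix iy] _] := xy.
    by case: (allA a) (allA b) => -> [->|->]; [left|right|right|left].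
    by subst b; apply: (nb v).
  apply: (nb (sigma C i0 a v)).
  - by rewrite -ab; apply: (root_sigma RS).
  - by apply: (root_sigma_nonneg RS) => //; apply: mixed_neq_alpha.
  - exact: sigma_mixed.
have in_spanN J v : in_span J (- v) -> in_span J v.
  by move=> H j /H; rewrite mxE => /eqP; rewrite oppr_eq0 => /eqP.
exists I1, (~: I1); split=> //; split=> //; split.
  by rewrite -setI_eq0 setICr.
split=> [|a v]; first by rewrite setUCr.
split=> [Rv|[[]//|[]//]].
have [J [JE vJ]] : exists J, (J = I1 \/ J = ~: I1) /\ in_span J v.
  have pos w : R a w -> nonneg w -> exists J, (J = I1 \/ J = ~: I1) /\ in_span J w.
    move=> Rw w0; apply: NNPP => no; apply: (nomix' a w Rw w0); split=> wJ; apply: no.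
      by exists I1; split=> //; left.
    by exists (~: I1); split=> //; right.
  have [v0|v0] := root_sign RS Rv; first exact: pos.
  have [J [JE vJ]] := pos _ (root_opp RS Rv) v0.
  by exists J; split=> //; apply: in_spanN.
by case: JE => JE; subst J; [left|right].
Qed.

End Reducibility.

(** * Classification *)

(** Used to enlarge a list of vertices by a neighbour when it does not yet exhaust the diagram. *)
Lemma indecomposable_exit n (M : 'M[int]_n) (l : seq 'I_n) i0 k :
  indecomposable M -> i0 \in l -> k \notin l ->
  exists i j, [/\ i \in l, j \notin l & M i j != 0].
Proof.
move=> indM i0l kl; apply: NNPP => no; apply: indM.
exists [set i | i \in l]; split; last split.
- by apply/set0Pn; exists i0; rewrite inE.
- by apply/set0Pn; exists k; rewrite !inE.
- move=> i j; rewrite !inE => il jl; apply/eqP/negPn/negP=> Mij.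
  by apply: no; exists i, j.
Qed.

Lemma product1 (a b : int) : a <= 0 -> b <= 0 -> a * b = 1 -> a = -1 /\ b = -1.
Proof.
move=> a0 b0 ab; have [an bn] : a < 0 /\ b < 0.
  have : a = 0 \/ a < 0 by lia.
  have : b = 0 \/ b < 0 by lia.
  by case=> [b1|b1] [a1|a1] //; rewrite ?a1 ?b1 ?mulr0 ?mul0r in ab.
have ab4 : a * b < 4 by rewrite ab.
by have [[a1 b1]|[[a1 b1]|[a1 b1]]] := small_product an bn ab4;
  rewrite a1 in ab; lia.
Qed.

Lemma product2 (a b : int) : a <= 0 -> b <= 0 -> a * b = 2 ->
  (a = -1 /\ b = -2) \/ (a = -2 /\ b = -1).
Proof.
move=> a0 b0 ab; have [an bn] : a < 0 /\ b < 0.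
  have : a = 0 \/ a < 0 by lia.
  have : b = 0 \/ b < 0 by lia.
  by case=> [b1|b1] [a1|a1] //; rewrite ?a1 ?b1 ?mulr0 ?mul0r in ab.
have ab4 : a * b < 4 by rewrite ab.
by have [[a1 b1]|[[a1 b1]|[a1 b1]]] := small_product an bn ab4;
  rewrite a1 in ab; lia.
Qed.

(** * The possible differences when C^x is positive and indecomposable *)

Section Core.
Variables (n : nat) (A : Type) (rho : 'I_n -> A -> A).
Variables (C : A -> 'M[int]_n) (R : A -> 'rV[int]_n -> Prop).
Hypothesis RS : root_system rho C R.
Hypothesis fR : finite_rs R.
Variables (sw : pred 'I_n) (x y : A) (F : realFieldType) (u : 'I_n -> F).
Hypothesis xy : two_objects rho sw x y.
Hypothesis ux : positive_on (C x) [set: 'I_n] u.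
Hypothesis indx : indecomposable (C x).

Let gx : gcm (C x) := rs_gcm RS x.
Let gy : gcm (C y) := rs_gcm RS y.
Let yx : two_objects rho sw y x := two_objects_sym xy.

Let neighbours i (l : seq 'I_n) : uniq (i :: l) ->
  \sum_(j <- l) C x i j * C x j i < 4.
Proof. by move=> uni; apply: (positive_on_neighbours gx ux uni) => j _; rewrite in_setT. Qed.

Let neq_fixed l p : sw l -> ~~ sw p -> l != p.
Proof. by move=> sl fp; apply: contraNneq fp => <-. Qed.

(** The degree bound at x excludes -4 and -5 for C x j i. The remaining triple edge exhausts the
    bound at both ends, so no third vertex can be attached. *)
Lemma swap_edge_differs i j : sw i -> ~~ sw j -> C x j i <> C y j i ->
  [/\ forall k, k \in [:: i; j], C x i j = -1, C x j i = -3 &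
      C y j i = -4 \/ C y j i = -5].
Proof.
move=> si fj xyji; have ij := neq_fixed si fj.
have ji : j != i by rewrite eq_sym.
have := neighbours (i := i) (l := [:: j]); rewrite big_seq1 /= inE ij => /(_ isT).
case: (rank2_cases RS fR xy si fj) => [[]//|[cij [[cji yji]|[_ [->|->]]]]];
  rewrite cij // => _.
split=> // k; apply/negPn/negP=> kl.
have [a [b [al bl Cab]]] := indecomposable_exit indx (mem_head i [:: j]) kl.
have ab : a != b by apply: contraNneq bl => <-.
have := gcm_product_ge1 gx ab Cab.
move: al bl; rewrite !inE negb_or => /orP[]/eqP aE /andP[bi bj]; subst a.
  have := neighbours (i := i) (l := [:: j; b]); rewrite big_cons big_seq1 /=.
  rewrite !inE !negb_or ij ab [j == b]eq_sym bj cij cji => /(_ isT).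
  by move: (C x i b * _) => z; lia.
have := neighbours (i := j) (l := [:: i; b]); rewrite big_cons big_seq1 /=.
rewrite !inE !negb_or ji ab [i == b]eq_sym bi cij cji => /(_ isT).
by move: (C x j b * _) => z; lia.
Qed.

Hypothesis swap_edge : forall i j, sw i -> ~~ sw j -> C x j i = C y j i.

(** Symmetric in p and q, so that p can be taken to be the one adjacent to an exchanged vertex.
    Under [swap_edge] the matrices can disagree only at two fixed indices. *)
Definition differ (p q : 'I_n) := C x p q <> C y p q \/ C x q p <> C y q p.

Lemma differ_adjacent l p q : sw l -> ~~ sw p -> ~~ sw q -> p != q ->
  differ p q -> C x l p != 0 \/ C x l q != 0.
Proof.
move=> sl fp fq pq dpq; have [lp0|] := eqVneq (C x l p) 0; last by left.
have [lq0|] := eqVneq (C x l q) 0; last by right.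
have l_p := neq_fixed sl fp; have l_q := neq_fixed sl fq.
case: dpq => []; [rewrite (fixed_nonadjacent RS xy sl (p := p) (q := q)) //|
  rewrite (fixed_nonadjacent RS xy sl (p := q) (q := p)) //].
by rewrite eq_sym.
Qed.

(** The edge l p is multiple, and the edge p q is present because both matrices have the same zeros.
    The degree bound at p then leaves 2 + 1, and the bound at l excludes a second multiple edge l
    q. *)
Lemma chain_at_x l p q : sw l -> ~~ sw p -> ~~ sw q -> p != q ->
  differ p q -> C x l p != 0 ->
  [/\ C x l p * C x p l = 2, C x p q = -1, C x q p = -1, C x l q = 0 & C x q l = 0].
Proof.
move=> sl fp fq pq dpq lp.
have l_p := neq_fixed sl fp; have l_q := neq_fixed sl fq.
have lp2 := rank2_product_ge2 RS fR xy sl fp lp.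
have pq0 : C x p q != 0.
  apply/negP=> /eqP pq0; have [_ [_ gx0]] := gx.
  have qp0 := gx0 _ _ pq0; case: dpq => [].
    by rewrite pq0 (cartan_zero RS fR xy sl pq0).
  by rewrite qp0 (cartan_zero RS fR xy sl qp0).
have pq1 := gcm_product_ge1 gx pq pq0.
have := neighbours (i := p) (l := [:: l; q]); rewrite big_cons big_seq1 /=.
rewrite !inE !negb_or eq_sym l_p pq l_q [C x p l * _]mulrC => /(_ isT) sum4.
have lq : C x l q = 0.
  apply/eqP/negPn/negP=> lq; have lq2 := rank2_product_ge2 RS fR xy sl fq lq.
  have := neighbours (i := l) (l := [:: p; q]); rewrite big_cons big_seq1 /=.
  rewrite !inE !negb_or l_p l_q pq => /(_ isT).
  by move: (_ * _) (_ * _) lp2 lq2 => a b; lia.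
have [_ [gx0 gx00]] := gx.
have c1 := gx0 p q pq; have c2 : C x q p <= 0 by apply: gx0; rewrite eq_sym.
have [c3 c4] : C x l p * C x p l = 2 /\ C x p q * C x q p = 1.
  by move: (C x l p * _) (C x p q * _) lp2 pq1 sum4 => a b; lia.
have [c5 c6] := product1 c1 c2 c4.
by split=> //; apply: gx00.
Qed.

Let sums_row (l : seq 'I_n) s t : uniq l ->
  simple_sums C sw x y [set k | k \in l] s t ->
  forall i, i \in l -> ~~ sw i ->
    \sum_(j <- l) C x i j * s 0 j = 2 /\ \sum_(j <- l) C y i j * t 0 j = 2.
Proof.
move=> ul [_ H2 H3 _] i il fi.
have iJ : i \in [set k | k \in l] by rewrite inE.
have [e1 e2] := H3 i iJ fi.
by split; [rewrite -e1|rewrite -e2]; rewrite (@pairing_support n _ i l) // => j jl;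
  have [] := H2 j _; rewrite ?inE.
Qed.

Let sums_swap (l : seq 'I_n) s t : uniq l ->
  simple_sums C sw x y [set k | k \in l] s t ->
  forall i, i \in l -> sw i ->
    t 0 i = s 0 i - (\sum_(j <- l) C x i j * s 0 j - 2) /\
    forall j, j != i -> t 0 j = s 0 j.
Proof.
move=> ul [_ H2 _ H4] i il si.
have iJ : i \in [set k | k \in l] by rewrite inE.
rewrite (H4 i iJ si) -(@pairing_support n _ i l) // => [|j jl]; last first.
  by have [] := H2 j _; rewrite ?inE.
split=> [|j ji]; rewrite !mxE ?eqxx ?mulr1 // (negPf ji) mulr0 subr0 //.
Qed.

(** A root reflected to x gives C y q p = -1. Positivity on {p, q}, where no index is exchanged,
    leaves -2 and -3 for the other entry, and the sums on {l, p, q} decide. *)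
Lemma chain_at_y l p q : sw l -> ~~ sw p -> ~~ sw q -> p != q ->
  differ p q -> C x l p != 0 -> C y p q = -2 /\ C y q p = -1.
Proof.
move=> sl fp fq pq dpq lp.
have [prod pqx qpx lqx qlx] := chain_at_x sl fp fq pq dpq lp.
have l_p := neq_fixed sl fp; have l_q := neq_fixed sl fq.
have p_l : p != l by rewrite eq_sym.
have q_l : q != l by rewrite eq_sym.
have q_p : q != p by rewrite eq_sym.
have [Cxii [gx0 gx00]] := gx; have [Cyii [gy0 gy00]] := gy.
have qpy0 : C y q p <> 0.
  move=> qp0; have [_ [_ yx0]] := gy.
  by have := cartan_zero RS fR yx sl qp0; rewrite qpx.
have qpy : C y q p = -1.
  (* At x the row of q takes the value 2e - 1 on the reflected root, whose coordinate there is e;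
     hence e <= 1. *)
  set e := - C y q p; have e1 : 1 <= e.
    by have := gy0 q p q_p; rewrite /e; move: (C y q p) qpy0 => z; clear; lia.
  have Rv : R y (alpha p + e *: alpha q) by rewrite scaleNr; apply: (root_string_end RS).
  have := root_swap RS yx sl Rv; rewrite sigmaE; set f := pairing _ _ _.
  set w := _ - _ => Rw.
  have wp : w 0 p = 1.
    by rewrite !mxE !eqxx (negPf pq) (negPf p_l) /= ?mulr0 ?mulr1 ?addr0 ?subr0 ?add0r.
  have wq : w 0 q = e.
    by rewrite !mxE !eqxx (negPf q_p) (negPf q_l) /= ?mulr0 ?mulr1 ?addr0 ?subr0 ?add0r.
  have w0 : nonneg w.
    have [//|/(_ p)] := root_sign RS Rw.
    by rewrite mxE wp.
  have wq' : w <> alpha q.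
    by move=> wE; move: wp; rewrite wE alphaE (negPf pq).
  have := root_pairing_le RS Rw w0 wq'.
  rewrite wq pairingD pairingN pairingD !pairingZ !pairing_alpha qpx qlx Cxii.
  by rewrite -[C y q p]opprK -/e; clear -e1; lia.
have [s' [t' st']] := simple_sums_exist RS [set k | k \in [:: p; q]] xy fR.
have yprod : C y p q * C y q p < 4.
  have upq : uniq [:: p; q] by rewrite /= inE pq.
  have pos : positive_on (C y) [set k | k \in [:: p; q]] (fun k => (t' 0 k)%:~R : F).
    apply: (simple_sums_positive F (simple_sums_sym RS xy st')) => k.
    by rewrite !inE => /orP[]/eqP->; rewrite ?(negPf fp) ?(negPf fq).
  have := positive_on_neighbours gy pos upq; rewrite big_seq1; apply=> k kl.
  by rewrite in_set.
have pqy0 := gy0 p q pq.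
have pqyn1 : C y p q <> -1 by move=> h; case: dpq; rewrite ?pqx ?qpx ?h ?qpy.
have pqyn0 : C y p q <> 0 by move/gy00; exact: qpy0.
have pqy : C y p q = -2 \/ C y p q = -3.
  by move: yprod; rewrite qpy; move: (C y p q) pqy0 pqyn1 pqyn0 => z; clear; lia.
(* With -3, eliminating the coordinate at l from [X1] and [Y1] gives b = 2c + 4 or b = 2c + 3,
   against 2c - b = 2 from [X2]. *)
split=> //; case: pqy => // pqy; exfalso.
have ul : uniq [:: l; p; q] by rewrite /= !inE negb_or l_p l_q pq.
have [s [t st]] := simple_sums_exist RS [set k | k \in [:: l; p; q]] xy fR.
have pl' : p \in [:: l; p; q] by rewrite !inE eqxx orbT.
have ql' : q \in [:: l; p; q] by rewrite !inE eqxx !orbT.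
have [X1 Y1] := sums_row ul st pl' fp; have [X2 Y2] := sums_row ul st ql' fq.
have [T1 T2] := sums_swap ul st (mem_head _ _) sl.
have Tp := T2 p p_l; have Tq := T2 q q_l.
have ypl := swap_edge sl fp; have yql := swap_edge sl fq.
rewrite !big_cons !big_nil ?Cxii ?Cyii -?ypl -?yql ?pqx ?qpx ?lqx ?qlx ?pqy ?qpy
  ?T1 ?Tp ?Tq in X1 Y1 X2 Y2 T1.
have := product2 (gx0 l p l_p) (gx0 p l p_l) prod.
rewrite {}T1 in Y1 *.
move: (s 0 l : int) (s 0 p : int) (s 0 q : int) X1 Y1 X2 => a b c.
by move=> X1 Y1 X2 [[e1 e2]|[e1 e2]]; rewrite e1 e2 in X1 Y1; clear -X1 X2 Y1; lia.
Qed.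

(** A second exchanged vertex violates the degree bound at p or creates a double chain through q. A
    further fixed vertex could only hang on q by a simple edge, and the sums on the four vertices
    rule this out. *)
Lemma chain_complete l p q : sw l -> ~~ sw p -> ~~ sw q -> p != q ->
  differ p q -> C x l p != 0 ->
  (forall l', sw l' -> l' = l) /\ (forall k, k \in [:: l; p; q]).
Proof.
move=> sl fp fq pq dpq lp.
have [prod pqx qpx lqx qlx] := chain_at_x sl fp fq pq dpq lp.
have [pqy qpy] := chain_at_y sl fp fq pq dpq lp.
have l_p := neq_fixed sl fp; have l_q := neq_fixed sl fq.
have p_l : p != l by rewrite eq_sym.
have q_l : q != l by rewrite eq_sym.
have q_p : q != p by rewrite eq_sym.
have lp2 : 2 <= C x l p * C x p l by rewrite prod.
have [Cxii [gx0 gx00]] := gx; have [Cyii [gy0 gy00]] := gy.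
have dqp : differ q p by case: dpq; [right|left].
have only l' : sw l' -> l' = l.
  move=> sl'; apply/eqP/negPn/negP=> l'l.
  have l'_p := neq_fixed sl' fp; have l'_q := neq_fixed sl' fq.
  have [l'p|l'q] := differ_adjacent sl' fp fq pq dpq.
    have [prod' _ _ _ _] := chain_at_x sl' fp fq pq dpq l'p.
    have := neighbours (i := p) (l := [:: l; l'; q]).
    rewrite !big_cons big_nil /= !inE !negb_or p_l [p == l']eq_sym l'_p pq.
    rewrite [l == l']eq_sym l'l l_q l'_q pqx qpx.
    by rewrite [C x p l * _]mulrC [C x p l' * _]mulrC prod prod' => /(_ isT).
  have [prod' _ _ _ _] := chain_at_x sl' fq fp q_p dqp l'q.
  apply: (positive_on_double_chain (l := l) (p := p) (q := q) (r := l') gx ux) => //.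
    rewrite /= !inE !negb_or l_p l_q [l == l']eq_sym l'l pq.
    by rewrite [p == l']eq_sym l'_p [q == l']eq_sym l'_q.
  by rewrite mulrC prod'.
split=> // k; apply/negPn/negP=> kl.
have [a [r [al rl Car]]] := indecomposable_exit indx (mem_head l [:: p; q]) kl.
move: rl; rewrite !inE !negb_or => /and3P[r_l r_p r_q].
have l_r : l != r by rewrite eq_sym.
have p_r : p != r by rewrite eq_sym.
have q_r : q != r by rewrite eq_sym.
have fr : ~~ sw r by apply/negP=> /only rl; rewrite rl eqxx in r_l.
have lr0 : C x l r = 0.
  apply/eqP/negPn/negP=> lr; have lr2 := rank2_product_ge2 RS fR xy sl fr lr.
  have := neighbours (i := l) (l := [:: p; r]); rewrite big_cons big_seq1 /=.
  rewrite !inE !negb_or l_p l_r p_r prod => /(_ isT).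
  by move: (C x l r * _) lr2 => z; clear; lia.
have pr0 : C x p r = 0.
  apply/eqP/negPn/negP=> pr; have pr1 := gcm_product_ge1 gx p_r pr.
  have := neighbours (i := p) (l := [:: l; q; r]).
  rewrite !big_cons big_nil /= !inE !negb_or p_l pq p_r l_q l_r q_r.
  rewrite [C x p l * _]mulrC prod pqx qpx => /(_ isT).
  by move: (C x p r * _) pr1 => z; clear; lia.
have qr : C x q r != 0.
  move: al Car; rewrite !inE => /or3P[]/eqP-> //.
    by rewrite lr0 eqxx.
  by rewrite pr0 eqxx.
have qr1 := gcm_product_ge1 gx q_r qr.
have qr_prod : C x q r * C x r q = 1.
  have le1 : C x q r * C x r q <= 2.
    have := neighbours (i := q) (l := [:: p; r]); rewrite big_cons big_seq1 /=.
    rewrite !inE !negb_or q_p q_r p_r qpx pqx => /(_ isT).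
    by move: (C x q r * _) => z; clear; lia.
  have [qr2|] : 2 <= C x q r * C x r q \/ C x q r * C x r q = 1.
    by move: (C x q r * _) qr1 => z; clear; lia.
  - exfalso; apply: (positive_on_double_chain (l := l) (p := p) (q := q) (r := r) gx ux) => //.
    by rewrite /= !inE !negb_or l_p l_q l_r pq p_r q_r.
  - by [].
have [qrx rqx] : C x q r = -1 /\ C x r q = -1.
  by apply: product1 => //; apply: gx0.
have qry : C y q r = -1.
  by rewrite -(fixed_nonadjacent RS xy sl q_r l_q l_r lqx lr0).
have rqy : C y r q = -1.
  by rewrite -(fixed_nonadjacent RS xy sl r_q l_r l_q lr0 lqx).
have pry : C y p r = 0 := cartan_zero RS fR xy sl pr0.
have rpx := gx00 _ _ pr0; have rpy := gy00 _ _ pry; have rlx := gx00 _ _ lr0.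
have ul : uniq [:: l; p; q; r] by rewrite /= !inE !negb_or l_p l_q l_r pq p_r q_r.
(* [X2] and [X3] yield 3c - 2b = 6, whereas [X1] and [Y1] yield 2b - 3c = 8 or 6. *)
have [s [t st]] := simple_sums_exist RS [set k | k \in [:: l; p; q; r]] xy fR.
have pJ : p \in [:: l; p; q; r] by rewrite !inE eqxx !orbT.
have qJ : q \in [:: l; p; q; r] by rewrite !inE eqxx !orbT.
have rJ : r \in [:: l; p; q; r] by rewrite !inE eqxx !orbT.
have [X1 Y1] := sums_row ul st pJ fp; have [X2 _] := sums_row ul st qJ fq.
have [X3 _] := sums_row ul st rJ fr.
have [T1 T2] := sums_swap ul st (mem_head _ _) sl.
have Tp := T2 p p_l; have Tq := T2 q q_l; have Tr := T2 r r_l.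
have ypl := swap_edge sl fp.
rewrite !big_cons !big_nil ?Cxii ?Cyii -?ypl ?pqx ?qpx ?lqx ?qlx ?pqy ?qpy
  ?lr0 ?rlx ?pr0 ?rpx ?pry ?qrx ?rqx ?T1 ?Tp ?Tq ?Tr in X1 Y1 X2 X3 T1.
have := product2 (gx0 l p l_p) (gx0 p l p_l) prod.
rewrite {}T1 in Y1 *.
move: (s 0 l : int) (s 0 p : int) (s 0 q : int) (s 0 r : int) X1 Y1 X2 X3 => a' b c d.
by move=> X1 Y1 X2 X3 [[e1 e2]|[e1 e2]]; rewrite e1 e2 in X1 Y1; clear -X1 X2 X3 Y1; lia.
Qed.

End Core.

(** * The converse *)

Lemma relabel1 n (M : 'M[int]_n) : relabel 1 M = M.
Proof. by apply/matrixP=> i j; rewrite mxE !perm1. Qed.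

Lemma relabel_inj n (p : {perm 'I_n}) : injective (relabel p).
Proof.
move=> M N /matrixP MN; apply/matrixP=> i j.
by have := MN (p^-1 i)%g (p^-1 j)%g; rewrite !mxE !permKV.
Qed.

Lemma positive_on_relabel (F : realFieldType) n (p : {perm 'I_n}) (M : 'M[int]_n)
    (u : 'I_n -> F) :
  positive_on (relabel p M) [set: 'I_n] u ->
  positive_on M [set: 'I_n] (fun i => u (p^-1 i)%g).
Proof.
move=> uM i _; have [ui] := uM (p^-1 i)%g (in_setT _); split=> //.
rewrite sum_setT (reindex_inj (@perm_inj _ p)) /=.
suff -> : \sum_j (M i (p j))%:~R * u (p^-1 (p j))%g =
  \sum_(j in [set: 'I_n]) (relabel p M (p^-1 i)%g j)%:~R * u j by [].
by rewrite sum_setT; apply: eq_bigr => j _; rewrite mxE permK permKV.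
Qed.

Lemma indecomposable_relabel n (p : {perm 'I_n}) (M : 'M[int]_n) :
  indecomposable (relabel p M) -> indecomposable M.
Proof.
move=> ind [J [Jn [Jcn JM]]]; apply: ind; exists (p @^-1: J); split; last split.
- have [i iJ] := set0Pn _ Jn; apply/set0Pn; exists (p^-1 i)%g.
  by rewrite inE permKV.
- have [i iJ] := set0Pn _ Jcn; apply/set0Pn; exists (p^-1 i)%g.
  by rewrite !inE permKV in iJ *.
- by move=> i j; rewrite !inE mxE; apply: JM.
Qed.

(** Consecutive vertices are joined in both directions, so membership in a separating set is
    constant along the chain. *)
Lemma indecomposable_chain n (M : 'M[int]_n.+1) :
  (forall i j : 'I_n.+1, j = i.+1 :> nat -> M i j != 0 /\ M j i != 0) ->
  indecomposable M.
Proof.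
move=> chain [J [/set0Pn[i iJ] [/set0Pn[j jJ] JM]]].
have const k : (k < n.+1)%N -> (inord k \in J) = (ord0 \in J).
  elim: k => [|k IH] kn.
    by rewrite (_ : inord 0 = ord0) //; apply: val_inj; rewrite /= inordK.
  rewrite -IH 1?ltnW //.
  have [] := chain (inord k) (inord k.+1); first by rewrite !inordK // ltnW.
  move=> /eqP H1 /eqP H2; apply/idP/idP => kJ; apply/negPn/negP => k1J.
    by apply: H2; apply: JM.
  by apply: H1; apply: JM.
move: iJ jJ; rewrite inE -[i]inord_val -[j]inord_val !const // => ->.
by [].
Qed.

(** [mx_is] does not fix the lengths of the rows; the size check makes them equal as lists. *)
Lemma mx_is_table n (p : {perm 'I_n}) (A : Type) (C : A -> 'M[int]_n) a i0 T :
  mx_is (relabel p (C a)) T -> all (fun r => size r == n) T ->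
  is_table C a [seq p i | i <- enum 'I_n] i0 T.
Proof.
move=> [sT TE] /allP rows k; rewrite size_map size_enum_ord => kn.
have nk : nth [::] T k \in T by rewrite mem_nth ?sT.
apply: (@eq_from_nth _ 0) => [|j]; rewrite (eqP (rows _ nk)).
  by rewrite size_map size_map size_enum_ord.
move=> jn; rewrite -(TE (Ordinal kn) (Ordinal jn)) mxE -map_comp.
have oE m (mn : (m < n)%N) : nth (Ordinal kn) (enum 'I_n) m = Ordinal mn.
  by apply: val_inj; rewrite /= nth_enum_ord.
rewrite (nth_map (Ordinal kn)) ?size_enum_ord //.
by rewrite (nth_map (Ordinal kn)) ?size_enum_ord //= !oE.
Qed.

Section Converse.
Variables (n : nat) (A : Type) (rho : 'I_n -> A -> A).
Variables (C : A -> 'M[int]_n) (R : A -> 'rV[int]_n -> Prop).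
Hypothesis RS : root_system rho C R.
Variables (x y : A) (p : {perm 'I_n}).
Hypothesis allA : forall a, a = x \/ a = y.
Hypothesis xy : two_objects rho (fun i : 'I_n => (i < 1)%N) x y.
Hypothesis pE : forall i : 'I_n, (p i < 1)%N = (i < 1)%N.

Lemma finite_relabel_steps T U w : (0 < n)%N ->
  mx_is (relabel p (C x)) T -> mx_is (relabel p (C y)) U ->
  all (fun r => size r == n) T -> all (fun r => size r == n) U ->
  all (fun k => k < n)%N w ->
  all (fun k => all (fun z => z <= 0) (steps T U w [seq (j == k)%:R | j <- iota 0 n]))
    (iota 0 n) ->
  finite_rs R.
Proof.
move=> n0 Tx Uy sT sU wn neg; pose i0 := Ordinal n0.
have tx := mx_is_table i0 Tx sT; have ty := mx_is_table i0 Uy sU.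
have [_ Hs Hf] := xy.
set l := [seq p i | i <- enum 'I_n] in tx ty.
have sl : size l = n by rewrite size_map size_enum_ord.
have lE k (kn : (k < n)%N) : nth i0 l k = p (Ordinal kn).
  rewrite (nth_map i0) ?size_enum_ord //; congr (p _).
  by apply: val_inj; rewrite /= nth_enum_ord.
have r k : (k < n)%N ->
    rho (nth i0 l k) x = (if k == 0%N then y else x) /\
    rho (nth i0 l k) y = (if k == 0%N then x else y).
  move=> kn; rewrite lE; case: eqP => k0.
    by apply: Hs; rewrite pE /= k0.
  by apply: Hf; rewrite pE /= -leqNgt lt0n; apply/eqP.
have lall i : i \in l.
  by rewrite -(permKV p i) map_f // mem_enum.
have fx : exists s : seq 'rV[int]_n, forall v, R x v -> v \in s.
  apply: (finite_steps RS (i0 := i0) (w := w) tx ty) => //; rewrite ?sl //.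
    by move=> k /r[].
  by move=> k /r[].
move=> a; case: (allA a) => ->//.
have [ix _] := Hs i0 isT; rewrite -ix.
exact: (finite_rho RS).
Qed.

End Converse.

Lemma exceptional_finite n (A : Type) (rho : 'I_n -> A -> A) (C : A -> 'M[int]_n)
    (R : A -> 'rV[int]_n -> Prop) (x y : A) (p : {perm 'I_n}) kappa :
  root_system rho C R -> (forall a, a = x \/ a = y) ->
  two_objects rho (fun i : 'I_n => (i < kappa)%N) x y ->
  (forall i : 'I_n, (p i < kappa)%N = (i < kappa)%N) ->
  (n = 2%N /\ kappa = 1%N /\ exists d : int, (d = -4 \/ d = -5) /\
     mx_is (relabel p (C x)) [:: [:: 2; -1]; [:: -3; 2]] /\
     mx_is (relabel p (C y)) [:: [:: 2; -1]; [:: d; 2]]) \/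
  (n = 3%N /\ kappa = 1%N /\
     mx_is (relabel p (C x)) [:: [:: 2; -1; 0]; [:: -2; 2; -1]; [:: 0; -1; 2]] /\
     mx_is (relabel p (C y)) [:: [:: 2; -1; 0]; [:: -2; 2; -2]; [:: 0; -1; 2]]) \/
  (n = 3%N /\ kappa = 1%N /\
     mx_is (relabel p (C x)) [:: [:: 2; -2; 0]; [:: -1; 2; -1]; [:: 0; -1; 2]] /\
     mx_is (relabel p (C y)) [:: [:: 2; -2; 0]; [:: -1; 2; -2]; [:: 0; -1; 2]]) ->
  finite_rs R /\ indecomposable (C x).
Proof.
move=> RS allA xy pE.
have chain (M : 'M[int]_n) : n = 2%N \/ n = 3%N ->
    (forall i j : 'I_n, j = i.+1 :> nat -> M i j != 0 /\ M j i != 0) ->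
    indecomposable M.
  by case=> ?; subst n; apply: indecomposable_chain.
(* This word sends all simple roots to negative ones in both rank three cases. Each letter changes
   the sign of at most one positive root, so its length 13 also bounds their number. *)
pose w3 := [:: 0; 1; 0; 1; 2; 1; 0; 1; 2; 1; 0; 1; 2]%N.
case=> [[n2 [k1 [d [dE [Mx My]]]]]|[[n3 [k1 [Mx My]]]|[n3 [k1 [Mx My]]]]]; subst n kappa.
- split.
    (* The words have lengths 8 for -4 and 12 for -5, again bounding the number of positive
       roots. *)
    case: dE => dE; subst d;
      [apply: (finite_relabel_steps RS allA xy pE isT Mx My
        (w := [:: 0; 1; 0; 1; 0; 1; 0; 1]%N))
      |apply: (finite_relabel_steps RS allA xy pE isT Mx My
        (w := [:: 0; 1; 0; 1; 0; 1; 0; 1; 0; 1; 0; 1]%N))]; by vm_compute.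
  apply: (@indecomposable_relabel _ p); apply: chain; first by left.
  case: Mx => _ ME i j ij; rewrite !ME.
  by case: i j ij => [[|[|i]] hi] [[|[|j]] hj].
- split.
    by apply: (finite_relabel_steps RS allA xy pE isT Mx My (w := w3)); vm_compute.
  apply: (@indecomposable_relabel _ p); apply: chain; first by right.
  case: Mx => _ ME i j ij; rewrite !ME.
  by case: i j ij => [[|[|[|i]]] hi] [[|[|[|j]]] hj].
- split.
    by apply: (finite_relabel_steps RS allA xy pE isT Mx My (w := w3)); vm_compute.
  apply: (@indecomposable_relabel _ p); apply: chain; first by right.
  case: Mx => _ ME i j ij; rewrite !ME.
  by case: i j ij => [[|[|[|i]]] hi] [[|[|[|j]]] hj].
Qed.

Lemma ordinal_cover n (l : seq 'I_n) :
  uniq l -> (forall k, k \in l) -> n = size l.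
Proof.
move=> ul lall; apply/eqP; rewrite -{1}(size_enum_ord n) eqn_leq.
by rewrite !uniq_leq_size ?enum_uniq // => k _; rewrite ?mem_enum.
Qed.

(** * Assembling the list and relabelling the vertices *)

Section Forward.
Variables (n : nat) (A : Type) (rho : 'I_n -> A -> A).
Variables (C : A -> 'M[int]_n) (R : A -> 'rV[int]_n -> Prop) (kappa : nat).
Hypothesis RS : root_system rho C R.
Hypothesis fR : finite_rs R.
Hypothesis irr : irreducible R.
Hypothesis kn : (1 <= kappa <= n)%N.

Let sw : pred 'I_n := fun i => (i < kappa)%N.

Lemma two_vertex_case (x y : A) i j d :
  sw i -> ~~ sw j -> (forall k, k \in [:: i; j]) -> d = -4 \/ d = -5 ->
  C x i j = -1 -> C x j i = -3 -> C y i j = -1 -> C y j i = d ->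
  thm54_cases kappa (C x) (C y).
Proof.
rewrite /sw -leqNgt => ik kj ij_all dE cxij cxji cyij cyji.
have i_j : i != j by apply: contraTneq ik => ->; rewrite -leqNgt.
have [Cxii _] := rs_gcm RS x; have [Cyii _] := rs_gcm RS y.
have n2 : n = 2%N by apply: (ordinal_cover (l := [:: i; j])); rewrite //= inE i_j.
have [k1 i0 j1] : [/\ kappa = 1%N, i = 0%N :> nat & j = 1%N :> nat].
  by have := ltn_ord j; split; lia.
right; left; split=> //; split=> //; exists d; split=> //.
by split; split=> // a b;
  move: (ij_all a) (ij_all b); rewrite !inE => /orP[]/eqP-> /orP[]/eqP->;
  rewrite ?i0 ?j1 ?Cxii ?Cyii ?cxij ?cxji ?cyij ?cyji.
Qed.

Lemma three_vertex_perm (l p q : 'I_n) : sw l -> ~~ sw p -> ~~ sw q -> p != q ->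
  (forall l', sw l' -> l' = l) -> (forall k, k \in [:: l; p; q]) ->
  [/\ n = 3%N, kappa = 1%N & exists s : {perm 'I_n},
    (forall k : 'I_n, (s k < kappa)%N = (k < kappa)%N) /\
    forall k : 'I_n, s k = nth l [:: l; p; q] k].
Proof.
rewrite /sw -!leqNgt => lk kp kq pq only all3.
have l_p : l != p by apply: contraTneq lk => ->; rewrite -leqNgt.
have l_q : l != q by apply: contraTneq lk => ->; rewrite -leqNgt.
have n3 : n = 3%N.
  by apply: (ordinal_cover (l := [:: l; p; q])); rewrite //= !inE negb_or l_p l_q pq.
have n0 : (0 < n)%N by rewrite n3.
have n1 : (1 < n)%N by rewrite n3.
have l0 : l = 0%N :> nat by rewrite -(only (Ordinal n0)) //=; lia.
have k1 : kappa = 1%N.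
  have [k2|] := ltnP 1 kappa; last by lia.
  by have := only (Ordinal n1) k2 => /(congr1 val); rewrite /= l0.
have pq' : (p : nat) != q by [].
(* Vertex l is 0, so p and q are 1 and 2 in some order, and at most these two have to be
   transposed. *)
split=> //; exists (if (p < q)%N then 1%g else tperm p q); split=> k.
  case: ifP => _; first by rewrite perm1.
  by case: tpermP => [->|->|]; rewrite ?k1; lia.
have p3 : (p < 3)%N by have := ltn_ord p; lia.
have q3 : (q < 3)%N by have := ltn_ord q; lia.
have := all3 k; rewrite !inE => /or3P[]/eqP->; case: ifP => pq3.
- by rewrite perm1 l0.
- by rewrite tpermD 1?eq_sym // l0.
- by rewrite perm1 (_ : nat_of_ord p = 1%N) //; lia.
- by rewrite tpermL (_ : nat_of_ord p = 2%N) //; lia.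
- by rewrite perm1 (_ : nat_of_ord q = 2%N) //; lia.
- by rewrite tpermR (_ : nat_of_ord q = 1%N) //; lia.
Qed.

Lemma three_vertex_case (x y : A) (l p q : 'I_n) : sw l -> ~~ sw p -> ~~ sw q -> p != q ->
  (forall l', sw l' -> l' = l) -> (forall k, k \in [:: l; p; q]) ->
  (C x l p = -1 /\ C x p l = -2) \/ (C x l p = -2 /\ C x p l = -1) ->
  C y l p = C x l p -> C y p l = C x p l ->
  C x l q = 0 -> C x q l = 0 -> C y l q = 0 -> C y q l = 0 ->
  C x p q = -1 -> C x q p = -1 -> C y p q = -2 -> C y q p = -1 ->
  exists s : {perm 'I_n}, (forall i : 'I_n, (s i < kappa)%N = (i < kappa)%N) /\
    thm54_cases kappa (relabel s (C x)) (relabel s (C y)).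
Proof.
move=> sl fp fq pq only all3 lp ylp ypl c1 c2 c3 c4 c5 c6 c7 c8.
have [n3 k1 [s [sk sE]]] := three_vertex_perm sl fp fq pq only all3.
exists s; split=> //.
have [Cxii _] := rs_gcm RS x; have [Cyii _] := rs_gcm RS y.
have lt3 (k : 'I_n) : (k < 3)%N by have := ltn_ord k; lia.
right; right; case: lp => [[lp pl]|[lp pl]]; [left|right]; do 2!split=> //;
  rewrite lp in ylp; rewrite pl in ypl;
  by split; split=> // a b; rewrite mxE !sE;
  have := lt3 a; have := lt3 b;
  case: (nat_of_ord a) => [|[|[|//]]]; case: (nat_of_ord b) => [|[|[|//]]] //= _ _.
Qed.

Lemma forward_half x y s t :
  two_objects rho sw x y -> (forall a, a = x \/ a = y) ->
  simple_sums C sw x y [set: 'I_n] s t ->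
  (forall i, i \in [set: 'I_n] -> sw i -> 2 <= pairing (C x) i s) ->
  exists p : {perm 'I_n}, (forall i : 'I_n, (p i < kappa)%N = (i < kappa)%N) /\
    thm54_cases kappa (relabel p (C x)) (relabel p (C y)).
Proof.
move=> xy allA st Hs; have /andP[k0 kle] := kn.
have n0 : (0 < n)%N := leq_trans k0 kle.
have s0 : sw (Ordinal n0) := k0.
have ux := simple_sums_positive Rdefinitions.R st Hs.
have [Cxii [gx0 gx00]] := rs_gcm RS x; have [Cyii [gy0 gy00]] := rs_gcm RS y.
have indx : indecomposable (C x).
  move=> [I1 [I1n [I1cn I1C]]]; apply: irr.
  have bdx : block_diagonal I1 (C x).
    move=> i j; have [iI|iI] := boolP (i \in I1).
      by rewrite eq_sym eqb_id; apply: I1C.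
    by rewrite eq_sym eqbF_neg negbK => jI; apply/gx00/I1C.
  apply: (block_diagonal_reducible RS fR xy allA s0 I1n I1cn bdx) => i j ij.
  exact/(cartan_zero RS fR xy s0)/bdx.
have [Cxy|Cxy] := eqVneq (C x) (C y).
  exists 1%g; split=> [i|]; first by rewrite perm1.
  rewrite !relabel1; left; split=> //; split.
    exact: positive_finite_type (rs_gcm RS x) indx ux.
  split=> // i j ik kj; have fj : ~~ sw j by rewrite /sw -leqNgt.
  have [[_ /eqP//]|[_]] := rank2_cases RS fR xy (ik : sw i) fj.
  by rewrite -Cxy => -[[-> []]|[-> []]].
have [i [j Cij]] : exists i j, C x i j <> C y i j.
  apply: NNPP => no; case/eqP: Cxy; apply/matrixP=> i j; apply: NNPP => Cij.
  by apply: no; exists i, j.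
have [edge|noedge] := classic (forall i j, sw i -> ~~ sw j -> C x j i = C y j i); last first.
  have [i' [j' [si' [fj' Cij']]]] :
      exists i j, sw i /\ ~~ sw j /\ C x j i <> C y j i.
    apply: NNPP => no; apply: noedge => i' j' si' fj'; apply: NNPP => Cij'.
    by apply: no; exists i', j'.
  have [all2 cx1 cx2 cy2] := swap_edge_differs RS fR xy ux indx si' fj' Cij'.
  exists 1%g; split=> [k|]; first by rewrite perm1.
  rewrite !relabel1; apply: (two_vertex_case si' fj' all2 cy2 cx1 cx2) => //.
  by rewrite -(cartan_swap RS j' xy si').
(* Rows of exchanged indices agree, and [edge] covers the columns of exchanged indices. *)
have fi : ~~ sw i by apply/negP=> /(cartan_swap RS j xy).
have fj : ~~ sw j by apply/negP=> /edge/(_ fi).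
have ij : i != j by apply/eqP=> ij; apply: Cij; rewrite ij Cxii Cyii.
(* The two indices are named so that p is adjacent to the exchanged vertex 0. *)
have [p [q [fp fq pq dpq lp]]] : exists p q,
    [/\ ~~ sw p, ~~ sw q, p != q, differ C x y p q & C x (Ordinal n0) p != 0].
  have dij : differ C x y i j by left.
  have [li|lj] := differ_adjacent RS xy s0 fi fj ij dij; first by exists i, j.
  by exists j, i; split=> //; [rewrite eq_sym|right].
have [prod c1 c2 c3 c4] := chain_at_x RS fR xy ux s0 fp fq pq dpq lp.
have [c5 c6] := chain_at_y RS fR xy ux edge s0 fp fq pq dpq lp.
have [only all3] := chain_complete RS fR xy ux indx edge s0 fp fq pq dpq lp.
have l_p : Ordinal n0 != p by apply: contraNneq fp => <-.
apply: (three_vertex_case s0 fp fq pq only all3) => //.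
- by apply: product2 => //; apply: gx0; rewrite // eq_sym.
- by rewrite -(cartan_swap RS p xy s0).
- by rewrite edge.
- by rewrite -(cartan_swap RS q xy s0).
- by rewrite -edge.
Qed.

End Forward.

Theorem theorem5p4 (theta : nat) (A : Type) (x y : A)
  (rho : 'I_theta -> A -> A) (C : A -> 'M[int]_theta)
  (R : A -> 'rV[int]_theta -> Prop) (kappa : nat) :
  (0 < theta)%N ->
  x <> y -> (forall a : A, a = x \/ a = y) ->
  cartan_scheme rho C -> connected rho ->
  root_system rho C R ->
  (1 <= kappa <= theta)%N ->
  (forall i : 'I_theta, (nat_of_ord i < kappa)%N -> rho i x = y /\ rho i y = x) ->
  (forall i : 'I_theta, (kappa <= nat_of_ord i)%N -> rho i x = x /\ rho i y = y) ->
  ((finite_rs R /\ irreducible R) <->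
   exists (x' y' : A) (p : {perm 'I_theta}),
     ((x' = x /\ y' = y) \/ (x' = y /\ y' = x)) /\
     (forall i : 'I_theta, (nat_of_ord (p i) < kappa)%N = (nat_of_ord i < kappa)%N) /\
     thm54_cases kappa (relabel p (C x')) (relabel p (C y'))).
Proof.
move=> n0 xny allA _ _ RS kn rho_swap rho_fix.
pose sw : pred 'I_theta := fun i => (i < kappa)%N.
have xy : two_objects rho sw x y.
  split=> [//|i si|i fi]; first exact: rho_swap si.
  by apply: rho_fix; rewrite leqNgt.
have yx := two_objects_sym xy.
have allA' a : a = y \/ a = x by case: (allA a); [right|left].
split=> [[fR irr]|[x' [y' [p [xyE [pE cases]]]]]].
  have [s [t st]] := simple_sums_exist RS [set: 'I_theta] xy fR.
  have [H|H] := simple_sums_dichotomy RS xy st.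
    have [p [pE cases]] := forward_half RS fR irr kn xy allA st H.
    by exists x, y, p; split; [left|].
  have ts := simple_sums_sym RS xy st.
  have [p [pE cases]] := forward_half RS fR irr kn yx allA' ts H.
  by exists y, x, p; split; [right|].
have [xy' allxy] : two_objects rho sw x' y' /\ forall a, a = x' \/ a = y'.
  by case: xyE => -[-> ->].
suff [fR indx] : finite_rs R /\ indecomposable (C x').
  split=> // red; apply: indx; exact: (reducible_decomposable RS x' red).
case: cases => [[Cxy [ft [ind _]]]|cases]; last first.
  exact: (exceptional_finite RS allxy xy' pE cases).
split; last exact: indecomposable_relabel ind.
have [u uM] := finite_type_positive ft.
apply: (finite_positive RS (M := C x') (Ordinal n0) _ (positive_on_relabel uM)) => a.
by case: (allxy a) => ->//; apply: (@relabel_inj _ p).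
Qed.
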